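(* Let $A,N_1,\dots,N_q\in\mathbb R^{n\times n}$, $B\in\mathbb R^{n\times m}$, $C\in\mathbb R^{p\times n}$ be such that $(A,B,N_i)$ is stabilizable, $(A,C,N_i)$ is observable, and the inequality $$A^\top P^{-1}+P^{-1}A+\sum_{i,j=1}^q N_i^\top P^{-1}N_jk_{ij}-C^\top C+P^{-1}BB^\top P^{-1}\le 0\qquad(\ast)$$ has a solution $P>0$. (a) Let $P>0$ satisfy $(\ast)$, let $(p_i)_{i=1}^n$ be an orthonormal basis of $\mathbb R^n$ of eigenvectors of $P$ with associated eigenvalues $\lambda_{P,i}$, let $T>0$, $u\in L^2_T$, and let $x(t)=x(t,0,u)$ be the state on $[0,T]$ with $x(0)=0$. Then for every $i$ $$\sup_{t\in[0,T]}\mathbb E\langle x(t),p_i\rangle_2^2\le\lambda_{P,i}\,J_T(0,u).$$ If $u$ is stabilizing, then the same holds for $T=\infty$, i.e. $\sup_{t\in[0,\infty)}\mathbb E\langle x(t),p_i\rangle_2^2\le\lambda_{P,i}J_\infty(0,u)$. (b) Let $Q\ge0$ satisfy $$A^\top Q+QA+\sum_{i,j=1}^q N_i^\top QN_jk_{ij}+C^\top C-QBB^\top Q=0,$$ be the stabilizing solution, and let $(q_i)_{i=1}^n$ be an orthonormal basis of $\mathbb R^n$ of eigenvectors of $Q$ with associated eigenvalues $\lambda_{Q,i}$. For the initial state $x_0=q_i$ and the stabilizing feedback input $u_F=Fx$, $F=-B^\top Q$, with resulting output $y(\cdot,q_i)$ and input $u_F(\cdot,q_i)$, $$J_\infty(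q_i,u_F)=\|y(\cdot,q_i)\|_{L^2}^2+\|u_F(\cdot,q_i)\|_{L^2}^2\le\lambda_{Q,i}.$$
   Context: Probability setting: $(\Omega,\mathcal F,(\mathcal F_t)_{t\ge0},\mathbb P)$ is a filtered probability space with right-continuous complete filtration; $W=(W_1,\dots,W_q)^\top$ is an adapted $\mathbb R^q$-valued mean-zero Wiener process with covariance matrix $K=(k_{ij})$, i.e. $\mathbb E[W(t)W(t)^\top]=Kt$, whose increments $W(t+h)-W(t)$ are independent of $\mathcal F_t$. For adapted processes, $\|v\|_{L^2_T}^2=\mathbb E\int_0^T\|v(s)\|_2^2ds$; $v\in L^2_T$ means this is finite, and $L^2$ denotes the case $T=\infty$. System: $dx(t)=[Ax(t)+Bu(t)]dt+\sum_{i=1}^qN_ix(t)dW_i(t)$, $x(0)=x_0\in\mathbb R^n$, $y(t)=Cx(t)$, with state and output written $x(\cdot,x_0,u)$, $y(\cdot,x_0,u)$. Cost functional: $J_T(x_0,u)=\int_0^T\mathbb E(\|u(t)\|_2^2+\|y(t)\|_2^2)dt$ with $y=y(\cdot,x_0,u)$, for $0<T\le\infty$. A control $u\in L^2$ is stabilizing (for initial state $x_0$) if $x(\cdot,x_0,u)\in L^2$. Definitions: $(A,N_i)$ is stable (mean square asymptotically) if there are $M\ge1$, $c>0$ with $\mathbb E\|x(t,x_0,0)\|_2^2\le Me^{-ct}\|x_0\|_2^2$ for all $x_0$, $t\ge0$. $(A,B,N_i)$ is stabilizable if for every $x_0$ there is $u\in L^2$ with $x(\cdot,x_0,u)\in L^2$.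 $(A,C,N_i)$ is observable if $y(t,x_0,0)=0$ a.s. for all $t\ge0$ implies $x_0=0$. A solution $Q$ of the Riccati equation in (b) is stabilizing if $(A-BB^\top Q,N_i)$ is stable. *)

(* Defs.v *)
From HB Require Import structures.
From mathcomp Require Export all_boot all_order all_algebra.
From mathcomp Require Export all_classical all_reals all_analysis.

Set Implicit Arguments.
Unset Strict Implicit.
Unset Printing Implicit Defensive.

Import Order.TTheory GRing.Theory Num.Theory.
Import numFieldNormedType.Exports.

Local Open Scope classical_set_scope.
Local Open Scope ring_scope.

Section linear_algebra.
Context {R : realType}.

Definition dotv n (v w : 'cV[R]_n) : R := (v^T *m w) 0 0.

Definition sqnorm n (v : 'cV[R]_n) : R := dotv v v.

Definition posdefmx n (M : 'M[R]_n) : Prop :=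
  M^T = M /\ forall v : 'cV[R]_n, v != 0 -> 0 < dotv v (M *m v).

Definition possemidefmx n (M : 'M[R]_n) : Prop :=
  M^T = M /\ forall v : 'cV[R]_n, 0 <= dotv v (M *m v).

Definition loewner_le n (M M' : 'M[R]_n) : Prop := possemidefmx (M' - M).

(* n orthonormal vectors of R^n automatically form a basis. *)
Definition orthonormal_eigenbasis n (M : 'M[R]_n) (e : 'I_n -> 'cV[R]_n)
    (lambda : 'I_n -> R) : Prop :=
  (forall i j, dotv (e i) (e j) = (i == j)%:R) /\
  (forall i, M *m e i = lambda i *: e i).

Definition noise_term n q (N : 'I_q -> 'M[R]_n) (K : 'M[R]_q) (X : 'M[R]_n) :
    'M[R]_n :=
  \sum_i \sum_j K i j *: ((N i)^T *m X *m N j).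

(* The inequality for P, with P^-1 as [invmx P]; it is only used together with
   [posdefmx P], so that P is invertible. *)
Definition reachability_ineq n m p q (A : 'M[R]_n) (B : 'M[R]_(n, m))
    (C : 'M[R]_(p, n)) (N : 'I_q -> 'M[R]_n) (K : 'M[R]_q) (P : 'M[R]_n) : Prop :=
  loewner_le (A^T *m invmx P + invmx P *m A + noise_term N K (invmx P)
        - C^T *m C + invmx P *m B *m B^T *m invmx P) 0.

Definition riccati_eq n m p q (A : 'M[R]_n) (B : 'M[R]_(n, m))
    (C : 'M[R]_(p, n)) (N : 'I_q -> 'M[R]_n) (K : 'M[R]_q) (Q : 'M[R]_n) : Prop :=
  A^T *m Q + Q *m A + noise_term N K Q + C^T *m C - Q *m B *m B^T *m Q = 0.

End linear_algebra.

Section stochastic_processes.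
Context {R : realType} {d : measure_display} {Omega : measurableType d}.
Variable Pr : probability Omega R.

Local Notation mu := (@lebesgue_measure R).

(* [0, T] for T real, [0, +oo[ for T = +oo *)
Definition times (T : \bar R) : set R := [set t | 0 <= t /\ (t%:E <= T)%E].

(* Times are reals; [F t] is only meaningful for 0 <= t. *)
Record is_filtration (F : R -> set_system Omega) : Prop := IsFiltration {
  filtration_sigma_algebra : forall t : R, 0 <= t -> sigma_algebra setT (F t) ;
  filtration_sub : forall t : R, 0 <= t -> F t `<=` measurable ;
  filtration_nondecreasing : forall s t : R, 0 <= s -> s <= t -> F s `<=` F t ;
  filtration_right_continuous : forall t : R, 0 <= t ->
    \bigcap_(s in [set s | t < s]) F s `<=` F t ;
  filtration_complete : forall E, Pr.-negligible E -> F 0 E }.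

Definition measurable_wrt (G : set_system Omega) (X : Omega -> R) : Prop :=
  forall E : set R, measurable E -> G (X @^-1` E).

Variable F : R -> set_system Omega.

Definition adapted n (T : \bar R) (v : R -> Omega -> 'cV[R]_n) : Prop :=
  forall t k, times T t -> measurable_wrt (F t) (fun w => v t w k 0).

Definition jointly_measurable n (T : \bar R) (v : R -> Omega -> 'cV[R]_n) : Prop :=
  forall k, measurable_fun (times T `*` [set: Omega])
    (fun z : R * Omega => v z.1 z.2 k 0).

Definition L2norm2 n (T : \bar R) (v : R -> Omega -> 'cV[R]_n) : \bar R :=
  (\int[Pr]_w \int[mu]_(s in times T) (sqnorm (v s w))%:E)%E.

Definition inL2 n (T : \bar R) (v : R -> Omega -> 'cV[R]_n) : Prop :=
  [/\ adapted T v, jointly_measurable T v & (L2norm2 T v < +oo)%E].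

Definition sigma_generated_by n (X : Omega -> 'cV[R]_n) : set_system Omega :=
  <<s [set G | exists k (E : set R),
         measurable E /\ G = (fun w => X w k 0) @^-1` E] >>.

Definition independent_of n (X : Omega -> 'cV[R]_n) (G : set_system Omega) : Prop :=
  forall E E', sigma_generated_by X E -> G E' -> (Pr (E `&` E') = Pr E * Pr E')%E.

(* X has law N(0, v); [normal_prob 0 0] is not the Dirac mass, so the degenerate
   case is treated apart. *)
Definition centered_gaussian (X : Omega -> R) (v : R) : Prop :=
  measurable_fun setT X /\
  if v == 0 then {ae Pr, forall w, X w = 0}
  else 0 < v /\ forall E : set R, measurable E ->
         Pr (X @^-1` E) = normal_prob 0 (Num.sqrt v) E.

(* Joint Gaussianity of the increments is expressed by that of all their linear
   combinations; K may be singular. *)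
Record is_wiener q (K : 'M[R]_q) (W : R -> Omega -> 'cV[R]_q) : Prop := IsWiener {
  wiener_adapted : adapted +oo%E W ;
  wiener0 : {ae Pr, forall w, W 0 w = 0} ;
  wiener_continuous : {ae Pr, forall w, forall i,
    {within times +oo%E, continuous (fun t => W t w i 0)}} ;
  wiener_indep : forall (t h : R), 0 <= t -> 0 <= h ->
    independent_of (fun w => W (t + h) w - W t w) (F t) ;
  wiener_gaussian : forall (t h : R) (a : 'cV[R]_q), 0 <= t -> 0 <= h ->
    centered_gaussian (fun w => dotv a (W (t + h) w - W t w))
      (h * dotv a (K *m a)) ;
  wiener_mean : forall (t : R) i, 0 <= t -> ('E_Pr[fun w => W t w i 0%R])%E = 0%E ;
  wiener_cov : forall (t : R) i j, 0 <= t ->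
    ('E_Pr[fun w => (W t w i 0 * W t w j 0)%R])%E = (K i j * t)%:E }.

(* Ito integral: L^2-limit of the integrals of the simple processes
   sum_(j < len) val_j 1_(]t_j, t_(j+1)]), with val_j bounded and
   F_(t_j)-measurable. *)
Record simple_process := SimpleProcess {
  sp_len : nat ;
  sp_time : nat -> R ;
  sp_val : nat -> Omega -> R ;
  sp_time_ge0 : 0 <= sp_time 0 ;
  sp_time_nondecreasing : forall j, sp_time j <= sp_time j.+1 ;
  sp_val_measurable : forall j, measurable_wrt (F (sp_time j)) (sp_val j) ;
  sp_val_bounded : forall j, exists M : R, forall w, `|sp_val j w| <= M }.

Definition sp_fun (phi : simple_process) (s : R) (w : Omega) : R :=
  \sum_(j < sp_len phi)
    sp_val phi j w * (sp_time phi j < s <= sp_time phi j.+1)%R%:R.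

Definition sp_integral (beta : R -> Omega -> R) (phi : simple_process) (t : R)
    (w : Omega) : R :=
  \sum_(j < sp_len phi) sp_val phi j w *
    (beta (Num.min (sp_time phi j.+1) t) w - beta (Num.min (sp_time phi j) t) w).

(* [Z] is (a version of) the Ito integral of f against beta over [0, t]. *)
Definition is_ito_integral (beta f : R -> Omega -> R) (t : R) (Z : Omega -> R) : Prop :=
  measurable_fun setT Z /\
  exists phi : nat -> simple_process,
    (fun k => \int[Pr]_w \int[mu]_(s in times t%:E)
       ((sp_fun (phi k) s w - f s w) ^+ 2)%:E)%E @ \oo --> 0%E /\
    (fun k => \int[Pr]_w
       ((sp_integral beta (phi k) t w - Z w) ^+ 2)%:E)%E @ \oo --> 0%E.

Variables (q : nat) (W : R -> Omega -> 'cV[R]_q).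

(* x solves dx = (A x + b) dt + sum_i N_i x dW_i, x(0) = x0, on [times T]: a
   continuous adapted process, locally in L^2, satisfying the integral equation
   almost surely at each time. Linear equations with b locally in L^2 have a
   unique such solution. *)
Definition is_solution n (A : 'M[R]_n) (N : 'I_q -> 'M[R]_n)
    (b : R -> Omega -> 'cV[R]_n) (T : \bar R) (x0 : 'cV[R]_n)
    (x : R -> Omega -> 'cV[R]_n) : Prop :=
  [/\ forall t, times T t -> inL2 t%:E x,
      adapted T x /\ jointly_measurable T x,
      {ae Pr, forall w, forall k, {within times T, continuous (fun t => x t w k 0)}} &
      forall t, times T t -> exists Z : 'I_q -> Omega -> 'cV[R]_n,
        (forall i k, is_ito_integral (fun s w => W s w i 0)
           (fun s w => (N i *m x s w) k 0) t (fun w => Z i w k 0)) /\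
        {ae Pr, forall w, x t w = x0
           + \col_k (\int[mu]_(s in times t%:E) (A *m x s w + b s w) k 0)%R
           + \sum_i Z i w}].

Definition is_state n m (A : 'M[R]_n) (B : 'M[R]_(n, m)) (N : 'I_q -> 'M[R]_n)
    (T : \bar R) (x0 : 'cV[R]_n) (u : R -> Omega -> 'cV[R]_m)
    (x : R -> Omega -> 'cV[R]_n) : Prop :=
  is_solution A N (fun t w => B *m u t w) T x0 x.

Definition output n p (C : 'M[R]_(p, n)) (x : R -> Omega -> 'cV[R]_n) :
    R -> Omega -> 'cV[R]_p := fun t w => C *m x t w.

Definition cost m p (T : \bar R) (u : R -> Omega -> 'cV[R]_m)
    (y : R -> Omega -> 'cV[R]_p) : \bar R :=
  (\int[mu]_(t in times T) 'E_Pr[fun w => (sqnorm (u t w) + sqnorm (y t w))%R])%E.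

Definition mean_square_stable n (A : 'M[R]_n) (N : 'I_q -> 'M[R]_n) : Prop :=
  exists M c : R, [/\ 1 <= M, 0 < c &
    forall x0 x, is_solution A N (fun _ _ => 0) +oo%E x0 x ->
    forall t : R, 0 <= t ->
      ('E_Pr[fun w => sqnorm (x t w)] <= (M * expR (- c * t) * sqnorm x0)%:E)%E].

Definition stabilizable n m (A : 'M[R]_n) (B : 'M[R]_(n, m))
    (N : 'I_q -> 'M[R]_n) : Prop :=
  forall x0, exists u x,
    [/\ inL2 +oo%E u, is_state A B N +oo%E x0 u x & inL2 +oo%E x].

Definition observable n p (A : 'M[R]_n) (C : 'M[R]_(p, n))
    (N : 'I_q -> 'M[R]_n) : Prop :=
  forall x0 x, is_solution A N (fun _ _ => 0) +oo%E x0 x ->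
    (forall t : R, 0 <= t -> {ae Pr, forall w, output C x t w = 0}) -> x0 = 0.

End stochastic_processes.

(* Main.v *)
From HB Require Import structures.
Require Import Defs.
From mathcomp Require Import measurable_realfun ring lra.

(** For a symmetric matrix X, Ito's formula in mean reads

      E x(t)'X x(t) = x0'X x0 + E int_0^t L_X(x, A x + b) ds,
      L_X(v, w) = v'X w + w'X v + sum_ij k_ij (N_i v)'X (N_j v).

    It is obtained from L^2 arguments only.  Write x = x0 + int a + M with
    M(t) the sum of the Ito integrals.  The Ito isometry computes E M M', the
    martingale property gives E M(t) a(s) = E M(s) a(s) for s <= t, and the
    pathwise product rule for int a takes care of the remaining terms: all
    contributions of int a to E x x' collapse to E int (x a' + a x').
    Isometry and martingale property pass to the limit from simple processes,
    where they follow from the independence of the increments of W together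
    with their mean and covariance.

    For X = P^-1 the inequality for P and Young's inequality give
    L_X(x, A x + B u) <= |u|^2 + |C x|^2, and <x, p_i>^2 <= lambda_i x'P^-1 x.
    For X = Q and u = -B'Q x the Riccati equation gives
    L_Q(x, A x + B u) = -(|u|^2 + |C x|^2), so that the cost on [0, t] is at most
    q_i'Q q_i = lambda_i; then t tends to infinity. *)

Set Implicit Arguments.
Unset Strict Implicit.
Unset Printing Implicit Defensive.
Import Order.TTheory GRing.Theory Num.Theory.
Import numFieldNormedType.Exports.

Local Open Scope classical_set_scope.
Local Open Scope ring_scope.

(** * Square-integrable functions *)

(** The obstacle is the mixed term E A(t) M(t), where A is the time integral of the drift a. Fubini
    turns it into the time integral of E a(s) M(t) = E a(s) M(s), and then M(s) is replaced by x(s)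
    - x0 - A(s). The terms -a(s) A(s) that arise are exactly those which the product rule for A
    cancels; this is the source of the collapse. What is left is bilinear algebra in two inner
    products, over Omega and over [0, t] x Omega, carried out on the entries x_k and x_l and
    contracted with X only at the end. Two points of integrability shape the argument. A solution is
    given as square-integrable over [0, t] x Omega only; that x(t) lies in L^2 at every single t has
    to be read off from the integral equation. And the Ito integrals at two times s < t come with
    unrelated approximating sequences, so that even the martingale property needs the isometry, to
    compare the two sequences on [0, s]. *)

Section square_integrable.
Context {d : measure_display} {T : measurableType d} {R : realType}.
Variables (m : {measure set T -> \bar R}) (D : set T).
Hypothesis mD : measurable D.
Implicit Types f g h : T -> R.

(** Members of L^2 are genuine functions, not classes. The main instances are [Pr] on Omega and the
    product of Lebesgue measure with [Pr] on [0, t] x Omega; Lebesgue measure on [0, t] serves for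
    single paths. *)
Definition sqint f := measurable_fun D f /\
  (\int[m]_(x in D) ((f x) ^+ 2)%:E < +oo)%E.

Definition ip f g : R := \int[m]_(x in D) (f x * g x).

(** Extended-valued squared distances, so that the second limit required by [is_ito_integral] is
    literally of this form. *)
Definition cvgL2 (u : nat -> T -> R) f : Prop :=
  (fun k => \int[m]_(x in D) ((u k x - f x) ^+ 2)%:E)%E @ \oo --> 0%E.

Lemma sqintP f :
  sqint f <-> measurable_fun D f /\ m.-integrable D (EFin \o (fun x => f x ^+ 2)).
Proof.
split=> [[mf foo]|[mf /integrableP[_ foo]]]; split => //.
- apply/integrableP; split.
    by apply/measurable_EFinP; exact: measurable_funX.
  rewrite (le_lt_trans _ foo)// le_eqVlt; apply/orP; left; apply/eqP.
  by apply: eq_integral => x _ /=; rewrite ger0_norm// sqr_ge0.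
- rewrite (le_lt_trans _ foo)// le_eqVlt; apply/orP; left; apply/eqP.
  by apply: eq_integral => x _ /=; rewrite ger0_norm// sqr_ge0.
Qed.

Lemma sqint_measurable f : sqint f -> measurable_fun D f.
Proof. by case. Qed.

Lemma le_sqint f g : measurable_fun D f -> sqint g ->
  (forall x, D x -> `|f x| <= `|g x|) -> sqint f.
Proof.
move=> mf /sqintP[mg ig] fg; apply/sqintP; split => //.
apply: le_integrable ig => //.
  by apply/measurable_EFinP; exact: measurable_funX.
move=> x Dx /=; rewrite lee_fin !normrX.
by rewrite lerXn2r ?nnegrE ?fg.
Qed.

Lemma eq_sqint f g : (forall x, D x -> f x = g x) -> sqint f -> sqint g.
Proof.
move=> fg sf; apply: le_sqint (sf) _ => [|x Dx]; last by rewrite fg.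
apply: eq_measurable_fun (sqint_measurable sf) => x /set_mem; exact: fg.
Qed.

(** Domination by |f g| <= f^2 + g^2. *)
Lemma integrable_sqintM f g : sqint f -> sqint g ->
  m.-integrable D (EFin \o (fun x => f x * g x)).
Proof.
move=> /sqintP[mf fi] /sqintP[mg gi].
have ifg := integrableD mD fi gi; apply: le_integrable ifg => //.
  by apply/measurable_EFinP; exact: measurable_funM.
move=> x _ /=; rewrite lee_fin [leRHS]ger0_norm ?addr_ge0 ?sqr_ge0//.
have := sqr_ge0 (`|f x| - `|g x|); have := sqr_ge0 (f x); have := sqr_ge0 (g x).
rewrite -[f x ^+ 2]real_normK ?num_real// -[g x ^+ 2]real_normK ?num_real//.
rewrite normrM; nra.
Qed.

Lemma sqintD f g : sqint f -> sqint g -> sqint (fun x => f x + g x).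
Proof.
move=> sf sg; have fg := integrable_sqintM sf sg.
move: sf sg => /sqintP[mf fi] /sqintP[mg gi].
apply/sqintP; split; first exact: measurable_funD.
have := integrableD mD (integrableD mD fi gi) (integrableZl mD 2 fg).
by apply: eq_integrable => // x _ /=; congr (_%:E); ring.
Qed.

Lemma sqintZ c f : sqint f -> sqint (fun x => c * f x).
Proof.
move=> /sqintP[mf fi]; apply/sqintP; split; first exact: measurable_funM.
have := integrableZl mD (c ^+ 2) fi.
by apply: eq_integrable => // x _ /=; congr (_%:E); ring.
Qed.

Lemma sqintB f g : sqint f -> sqint g -> sqint (fun x => f x - g x).
Proof.
move=> sf sg; have := sqintD sf (sqintZ (-1) sg).
by apply: eq_sqint => x _; rewrite mulN1r.
Qed.

Lemma sqint0 : sqint (fun=> 0).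
Proof.
split => //.
by rewrite (eq_integral (fun=> 0%E)) ?integral0// => x _; rewrite expr0n.
Qed.

Lemma sqint_sum (I : Type) (s : seq I) (f : I -> T -> R) :
  (forall i, sqint (f i)) -> sqint (fun x => \sum_(i <- s) f i x).
Proof.
move=> sf; elim: s => [|i s ih].
  by apply: eq_sqint sqint0 => x _; rewrite big_nil.
by apply: eq_sqint (sqintD (sf i) ih) => x _; rewrite big_cons.
Qed.

Lemma eq_ip f f' g g' : (forall x, D x -> f x = f' x) ->
  (forall x, D x -> g x = g' x) -> ip f g = ip f' g'.
Proof.
by move=> ff gg; apply: eq_Rintegral => x /set_mem Dx; rewrite ff ?gg.
Qed.

Lemma ipC f g : ip f g = ip g f.
Proof. by apply: eq_Rintegral => x _; rewrite mulrC. Qed.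

Lemma ipDl f g h : sqint f -> sqint g -> sqint h ->
  ip (fun x => f x + g x) h = ip f h + ip g h.
Proof.
move=> sf sg sh; rewrite -RintegralD//; try exact: integrable_sqintM.
by apply: eq_Rintegral => x _; rewrite mulrDl.
Qed.

Lemma ipZl c f g : sqint f -> sqint g ->
  ip (fun x => c * f x) g = c * ip f g.
Proof.
move=> sf sg; rewrite -RintegralZl//; last exact: integrable_sqintM.
by apply: eq_Rintegral => x _; rewrite mulrA.
Qed.

Lemma ipBl f g h : sqint f -> sqint g -> sqint h ->
  ip (fun x => f x - g x) h = ip f h - ip g h.
Proof.
move=> sf sg sh; rewrite -RintegralB//; try exact: integrable_sqintM.
by apply: eq_Rintegral => x _; rewrite mulrBl.
Qed.

Lemma ipDr f g h : sqint f -> sqint g -> sqint h ->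
  ip h (fun x => f x + g x) = ip h f + ip h g.
Proof. by move=> *; rewrite ipC ipDl// !(ipC h). Qed.

Lemma ipBr f g h : sqint f -> sqint g -> sqint h ->
  ip h (fun x => f x - g x) = ip h f - ip h g.
Proof. by move=> *; rewrite ipC ipBl// !(ipC h). Qed.

Lemma ipZr c f g : sqint f -> sqint g ->
  ip f (fun x => c * g x) = c * ip f g.
Proof. by move=> *; rewrite ipC ipZl// ipC. Qed.

Lemma ip0l f : ip (fun=> 0) f = 0.
Proof.
rewrite /ip (@eq_Rintegral _ _ _ _ _ (fun=> 0)) => [|x _]; last by rewrite mul0r.
by rewrite Rintegral_cst// mul0r.
Qed.

Lemma ip_suml (I : Type) (s : seq I) (f : I -> T -> R) g :
  (forall i, sqint (f i)) -> sqint g ->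
  ip (fun x => \sum_(i <- s) f i x) g = \sum_(i <- s) ip (f i) g.
Proof.
move=> sf sg; elim: s => [|i s ih].
  by rewrite big_nil -[RHS](ip0l g); apply: eq_ip => // x _; rewrite big_nil.
rewrite big_cons -ih -ipDl//; last exact: sqint_sum.
by apply: eq_ip => // x _; rewrite big_cons.
Qed.

Lemma ip_sumr (I : Type) (s : seq I) (f : I -> T -> R) g :
  (forall i, sqint (f i)) -> sqint g ->
  ip g (fun x => \sum_(i <- s) f i x) = \sum_(i <- s) ip g (f i).
Proof. by move=> *; rewrite ipC ip_suml//; apply: eq_bigr => i _; rewrite ipC. Qed.

Lemma ip_ge0 f : 0 <= ip f f.
Proof. by apply: Rintegral_ge0 => x _; rewrite -expr2 sqr_ge0. Qed.

Lemma EFin_ip f g : sqint f -> sqint g ->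
  (ip f g)%:E = (\int[m]_(x in D) (f x * g x)%:E)%E.
Proof.
by move=> sf sg; rewrite fineK//; apply: integrable_fin_num => //;
  exact: integrable_sqintM.
Qed.

Lemma EFin_ip_sqr f : sqint f ->
  (ip f f)%:E = (\int[m]_(x in D) ((f x) ^+ 2)%:E)%E.
Proof. by move=> sf; rewrite EFin_ip//; under eq_integral do rewrite -expr2. Qed.

(** The squared norm of f + c g is a polynomial in c that is never negative. *)
Lemma cauchy_schwarz f g : sqint f -> sqint g ->
  ip f g ^+ 2 <= ip f f * ip g g.
Proof.
move=> sf sg.
have H c : 0 <= ip f f + 2 * c * ip f g + c ^+ 2 * ip g g.
  have := ip_ge0 (fun x => f x + c * g x).
  have sc := sqintZ c sg.
  rewrite ipDl// ?ipDr//; last exact: sqintD.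
  rewrite !ipZl// !ipZr// (ipC g f) => /le_trans; apply.
  by rewrite le_eqVlt; apply/orP; left; apply/eqP; ring.
have := ip_ge0 g; rewrite le_eqVlt => /orP[/eqP g0|g0].
  rewrite -g0 mulr0; have [->|fg0] := eqVneq (ip f g) 0; first by rewrite expr0n.
  (* With g of norm zero the polynomial is affine in c; this c would give it the value -1. *)
  have := H (- (ip f f + 1) / (2 * ip f g)).
  rewrite -g0 mulr0 addr0 => H'.
  have : 0 <= ip f f + - (ip f f + 1).
    by rewrite (le_trans H')// le_eqVlt; apply/orP; left; apply/eqP; field.
  by move=> ?; exfalso; lra.
(* The minimizer of the polynomial. *)
have := H (- ip f g / ip g g) => H'.
have : 0 <= ip g g * (ip f f + 2 * (- ip f g / ip g g) * ip f g +
              (- ip f g / ip g g) ^+ 2 * ip g g) by rewrite mulr_ge0// ltW.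
rewrite (_ : _ * _ = ip f f * ip g g - ip f g ^+ 2) ?subr_ge0//.
by field; rewrite gt_eqF.
Qed.

Lemma norm_ip f g : sqint f -> sqint g ->
  `|ip f g| <= Num.sqrt (ip f f) * Num.sqrt (ip g g).
Proof.
move=> sf sg; rewrite -sqrtrM ?ip_ge0// -sqrtr_sqr ler_sqrt ?mulr_ge0 ?ip_ge0//.
exact: cauchy_schwarz.
Qed.

Section limits.
Variables (u : nat -> T -> R) (f : T -> R).
Hypothesis su : forall k, sqint (u k).
Hypothesis uf : cvgL2 u f.

(** Some u_k is at finite distance from f, and f = u_k - (u_k - f). *)
Lemma cvgL2_sqint : measurable_fun D f -> sqint f.
Proof.
move=> mf.
have [k uk] : exists k, (\int[m]_(x in D) ((u k x - f x) ^+ 2)%:E < +oo)%E.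
  have /(_ [set x | (x < +oo)%E])[|k _ /(_ k)] := uf.
    by apply: open_nbhs_nbhs; split; [exact: open_ereal_lt_ereal|exact: ltry].
  by move=> uk; exists k; exact: uk (leqnn k).
have suf : sqint (fun x => u k x - f x).
  by split => //; apply: measurable_funB => //; exact: sqint_measurable.
by apply: eq_sqint (sqintB (su k) suf) => x _; ring.
Qed.

Lemma cvgL2_ip : sqint f ->
  (fun k => Num.sqrt (ip (fun x => u k x - f x) (fun x => u k x - f x)))
    @ \oo --> (0 : R).
Proof.
move=> sf; rewrite -[0 : R]sqrtr0.
apply: (@continuous_cvg _ _ _ _ _ _ Num.sqrt); first exact: sqrt_continuous.
apply: cvg_trans (fine_cvg uf); apply: near_eq_cvg; near=> k => /=.
by rewrite -EFin_ip_sqr//; exact: sqintB.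
Unshelve. all: by end_near. Qed.

End limits.

(** The difference is <u-f, v-g> + <u-f, g> + <f, v-g>; Cauchy-Schwarz bounds the three terms by the
    sequence [b], which tends to 0. *)
Lemma ip_cvg (u v : nat -> T -> R) f g : (forall k, sqint (u k)) ->
  (forall k, sqint (v k)) -> sqint f -> sqint g -> cvgL2 u f -> cvgL2 v g ->
  (fun k => ip (u k) (v k)) @ \oo --> ip f g.
Proof.
move=> su sv sf sg uf vg; apply/subr_cvg0.
have e0 := cvgL2_ip su uf sf; have e1 := cvgL2_ip sv vg sg.
set e := (fun k => Num.sqrt _) in e0; set e' := (fun k => Num.sqrt _) in e1.
pose b k := e k * e' k + e k * Num.sqrt (ip g g) + Num.sqrt (ip f f) * e' k.
have b0 : b @ \oo --> (0 : R).
  have -> : (0 : R) = 0 * 0 + 0 * Num.sqrt (ip g g) + Num.sqrt (ip f f) * 0.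
    by rewrite !mulr0 mul0r !addr0.
  by apply: cvgD; [apply: cvgD|]; apply: cvgM => //; exact: cvg_cst.
apply/norm_cvg0P; apply: (squeeze_cvgr _ (cvg_cst (0 : R)) b0); near=> k.
rewrite normr_ge0/=.
have sa := sqintB (su k) sf; have sb := sqintB (sv k) sg.
have -> : ip (u k) (v k) - ip f g =
    ip (fun x => u k x - f x) (fun x => v k x - g x)
    + ip (fun x => u k x - f x) g + ip f (fun x => v k x - g x).
  rewrite ipBl// !(ipBr (h:=u k))// !(ipBr (h:=f))// ipBl//; ring.
rewrite (le_trans (ler_normD _ _))// lerD//; last exact: norm_ip.
by rewrite (le_trans (ler_normD _ _))// lerD//; exact: norm_ip.
Unshelve. all: by end_near. Qed.

Lemma cvgL2_cst f : cvgL2 (fun=> f) f.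
Proof.
rewrite /cvgL2 (_ : (fun _ => _) = fun=> 0%E); first exact: cvg_cst.
apply/funext => k; apply: integral0_eq => x _.
by rewrite subrr expr0n.
Qed.

End square_integrable.

(** * Independence and Wiener increments *)

Section independent_product.
Context {d : measure_display} {Omega : measurableType d} {R : realType}.
Variable Pr : probability Omega R.

(** The joint law of (V, Y) agrees with the product of the two laws on rectangles, hence everywhere;
    Fubini for the function z.1 * z.2 then factors the expectation. *)
Lemma expectation_indepM (V Y : {mfun Omega >-> R}) :
  (forall E E', measurable E -> measurable E' ->
     (Pr (V @^-1` E `&` Y @^-1` E') = Pr (V @^-1` E) * Pr (Y @^-1` E'))%E) ->
  Pr.-integrable setT (EFin \o V) -> Pr.-integrable setT (EFin \o Y) ->
  Pr.-integrable setT (EFin \o (fun w => V w * Y w)) ->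
  \int[Pr]_w (V w * Y w) = (\int[Pr]_w V w) * (\int[Pr]_w Y w).
Proof.
move=> VY iV iY iVY.
have mVY : measurable_fun setT (fun w => (V w, Y w)).
  exact: measurable_fun_pair.
pose VYm : {mfun Omega >-> (R * R)%type} := 
  HB.pack (fun w => (V w, Y w)) (isMeasurableFun.Build _ _ _ _ _ mVY).
pose mV := distribution Pr V; pose mY := distribution Pr Y.
have E X : measurable X -> (mV \x mY)%E X = pushforward Pr VYm X.
  apply: product_measure_unique => A B mA mB.
  by rewrite -VY.
pose f (z : R * R) := (z.1 * z.2)%:E.
have mf : measurable_fun setT f.
  by apply/measurable_EFinP; apply: measurable_funM.
have if1 : (pushforward Pr VYm).-integrable setT f by exact: integrable_pushforward.
have if2 : (mV \x mY)%E.-integrable setT f.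
  apply/integrableP; split => //.
  case/integrableP : if1 => _; apply: le_lt_trans.
  rewrite (eq_measure_integral (pushforward Pr VYm)) => [//|A mA _]; exact: E.
have mE : measurable_fun setT (EFin \o @idfun R).
  by apply/measurable_EFinP; exact: measurable_id.
have iVx : mV.-integrable setT (EFin \o @idfun R).
  exact: integrable_pushforward.
have iYx : mY.-integrable setT (EFin \o @idfun R).
  exact: integrable_pushforward.
rewrite /Rintegral.
transitivity (fine (\int[mV \x mY]_z f z))%E.
  congr fine; rewrite (eq_measure_integral (pushforward Pr VYm)); last first.
    by move=> A mA _; exact: E.
  by rewrite integral_pushforward.
rewrite -integral12_prod_meas1//= /fubini_F /f/=.
rewrite -fineM; try exact: integrable_fin_num.
congr fine.
have -> : (\int[Pr]_w (V w)%:E)%E = (\int[mV]_x x%:E)%E.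
  by rewrite integral_pushforward.
have -> : (\int[Pr]_w (Y w)%:E)%E = (\int[mY]_x x%:E)%E.
  by rewrite integral_pushforward.
have fY : (\int[mY]_x x%:E)%E \is a fin_num by exact: (integrable_fin_num _ iYx).
rewrite -(fineK fY) -integralZr//.
apply: eq_integral => x _; rewrite fineK//.
by under eq_integral do rewrite EFinM; rewrite integralZl.
Qed.

End independent_product.

Section measurable_wrt.
Context {d : measure_display} {Omega : measurableType d} {R : realType}.
Implicit Types (G : set_system Omega) (X Y : Omega -> R).

Lemma measurable_wrt_gen G X :
  measurable_fun setT (X : g_sigma_algebraType G -> R) <->
  measurable_wrt <<s G >> X.
Proof.
split=> [mX E mE|mX _ E mE].
  by have := mX measurableT E mE; rewrite setTI.
by rewrite setTI; exact: mX.
Qed.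

(** A filtration consists of bare set systems. Passing to the measurable type generated by G makes
    the closure properties of measurable functions available for [measurable_wrt]. *)
Lemma measurable_wrtP G X : sigma_algebra setT G ->
  measurable_wrt G X <-> measurable_fun setT (X : g_sigma_algebraType G -> R).
Proof. by move=> sG; rewrite measurable_wrt_gen sigma_algebra_id. Qed.

Lemma measurable_wrtB G X Y : sigma_algebra setT G -> measurable_wrt G X ->
  measurable_wrt G Y -> measurable_wrt G (fun w => X w - Y w).
Proof.
move=> sG /(measurable_wrtP _ sG) mX /(measurable_wrtP _ sG) mY.
by apply/(measurable_wrtP _ sG); exact: measurable_funB.
Qed.

Lemma measurable_wrtM G X Y : sigma_algebra setT G -> measurable_wrt G X ->
  measurable_wrt G Y -> measurable_wrt G (fun w => X w * Y w).
Proof.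
move=> sG /(measurable_wrtP _ sG) mX /(measurable_wrtP _ sG) mY.
by apply/(measurable_wrtP _ sG); exact: measurable_funM.
Qed.

Lemma measurable_wrtD G X Y : sigma_algebra setT G -> measurable_wrt G X ->
  measurable_wrt G Y -> measurable_wrt G (fun w => X w + Y w).
Proof.
move=> sG /(measurable_wrtP _ sG) mX /(measurable_wrtP _ sG) mY.
by apply/(measurable_wrtP _ sG); exact: measurable_funD.
Qed.

Lemma measurable_wrt_cst G c : sigma_algebra setT G ->
  measurable_wrt G (fun=> c : R).
Proof. by move=> sG; apply/(measurable_wrtP _ sG); exact: measurable_cst. Qed.

Lemma measurable_wrt_sum G (I : Type) (s : seq I) (X : I -> Omega -> R) :
  sigma_algebra setT G -> (forall i, measurable_wrt G (X i)) ->
  measurable_wrt G (fun w => \sum_(i <- s) X i w).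
Proof.
move=> sG mX; apply/(measurable_wrtP _ sG); apply: measurable_sum => i.
exact/(measurable_wrtP _ sG).
Qed.

Lemma measurable_wrt_sub G G' X : G `<=` G' -> measurable_wrt G X ->
  measurable_wrt G' X.
Proof. by move=> GG mX E mE; exact/GG/mX. Qed.

Lemma measurable_wrt_measurable G X : G `<=` measurable ->
  measurable_wrt G X -> measurable_fun setT X.
Proof. by move=> GG mX _ E mE; rewrite setTI; exact/GG/mX. Qed.

End measurable_wrt.

Section bounded_square_integrable.
Context {d : measure_display} {Omega : measurableType d} {R : realType}.
Variable Pr : probability Omega R.

Lemma sqint_cst c : sqint Pr setT (fun=> c).
Proof.
split => //.
rewrite integral_cst// [X in (_ * X)%E](_ : _ = 1%E) ?mule1 ?ltry//.
exact: probability_setT.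
Qed.

Lemma sqint_integrable (f : Omega -> R) :
  sqint Pr setT f -> Pr.-integrable setT (EFin \o f).
Proof.
move=> sf; have := integrable_sqintM measurableT sf (sqint_cst 1).
by apply: eq_integrable => // x _ /=; rewrite mulr1.
Qed.

Lemma sqint_boundedM (V f : Omega -> R) M : measurable_fun setT V ->
  (forall w, `|V w| <= M) -> sqint Pr setT f ->
  sqint Pr setT (fun w => V w * f w).
Proof.
move=> mV VM sf.
apply: le_sqint (sqintZ measurableT M sf) _ => //.
  by apply: measurable_funM => //; exact: sqint_measurable sf.
move=> w _; rewrite !normrM ler_wpM2r// (le_trans (VM w))//.
exact: ler_norm.
Qed.

End bounded_square_integrable.

Section wiener_increments.
Context {R : realType} {d : measure_display} {Omega : measurableType d}.
Variables (Pr : probability Omega R) (F : R -> set_system Omega).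
Hypothesis HF : is_filtration Pr F.
Variables (q : nat) (K : 'M[R]_q) (W : R -> Omega -> 'cV[R]_q).
Hypothesis HW : is_wiener Pr F K W.

Definition wincr i a b w := W b w i 0 - W a w i 0.

Local Notation ipP := (ip Pr setT).
Local Notation sqP := (sqint Pr setT).

Lemma filtration_measurable t (X : Omega -> R) : 0 <= t ->
  measurable_wrt (F t) X -> measurable_fun setT X.
Proof.
by move=> t0; apply: measurable_wrt_measurable; exact: filtration_sub HF _ t0.
Qed.

Lemma filtration_le s t (X : Omega -> R) : 0 <= s -> s <= t ->
  measurable_wrt (F s) X -> measurable_wrt (F t) X.
Proof.
by move=> s0 st; apply: measurable_wrt_sub; exact: filtration_nondecreasing HF _ _ s0 st.
Qed.

Lemma wiener_wrt t i : 0 <= t -> measurable_wrt (F t) (fun w => W t w i 0).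
Proof. by move=> t0; apply: (wiener_adapted HW); split => //; exact: leey. Qed.

Lemma sqint_wiener t i : 0 <= t -> sqP (fun w => W t w i 0).
Proof.
move=> t0; split.
  by apply: (filtration_measurable t0); exact: wiener_wrt.
have := wiener_cov HW i i t0; rewrite unlock => covW.
by under eq_integral do rewrite expr2; rewrite covW ltry.
Qed.

Lemma sqint_incr i a b : 0 <= a -> 0 <= b -> sqP (wincr i a b).
Proof. by move=> a0 b0; apply: sqintB => //; exact: sqint_wiener. Qed.

Lemma incr_wrt i a b c : 0 <= a -> a <= c -> 0 <= b -> b <= c ->
  measurable_wrt (F c) (wincr i a b).
Proof.
move=> a0 ac b0 bc; apply: measurable_wrtB.
- by apply: filtration_sigma_algebra HF _ _; rewrite (le_trans a0).
- by apply: (@filtration_le b) => //; exact: wiener_wrt.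
- by apply: (@filtration_le a) => //; exact: wiener_wrt.
Qed.

(** Generators of the sigma-algebra of the whole vector W(b) - W(a). All components are needed at
    once, because independence is also applied to products of two different components. *)
Let incr_gen a b : set_system Omega := [set G | exists k (E : set R),
  measurable E /\ G = (fun w => (W b w - W a w) k 0) @^-1` E].

Lemma incr_measurable_gen i a b :
  measurable_fun setT (wincr i a b : g_sigma_algebraType (incr_gen a b) -> R).
Proof.
apply/measurable_wrt_gen => E mE; apply: sub_sigma_algebra.
by exists i, E; split => //; apply/seteqP; split => w; rewrite /= /wincr !mxE.
Qed.

(** [wiener_indep] is used with t = a and h = b - a. *)
Lemma incr_indepM a b (V Y : Omega -> R) : 0 <= a -> a <= b ->
  measurable_wrt (F a) V -> Pr.-integrable setT (EFin \o V) ->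
  measurable_fun setT (Y : g_sigma_algebraType (incr_gen a b) -> R) ->
  Pr.-integrable setT (EFin \o Y) ->
  Pr.-integrable setT (EFin \o (fun w => V w * Y w)) ->
  \int[Pr]_w (V w * Y w) = (\int[Pr]_w V w) * (\int[Pr]_w Y w).
Proof.
move=> a0 ab mV iV mY iY iVY.
have mV' : measurable_fun setT V by exact: filtration_measurable mV.
have mY' : measurable_fun setT Y.
  by have /measurable_EFinP := measurable_int _ iY.
pose Vm : {mfun Omega >-> R} := HB.pack V (isMeasurableFun.Build _ _ _ _ _ mV').
pose Ym : {mfun Omega >-> R} := HB.pack Y (isMeasurableFun.Build _ _ _ _ _ mY').
apply: (@expectation_indepM _ _ _ _ Vm Ym) => // E E' mE mE'.
rewrite setIC muleC.
have ba0 : 0 <= b - a by rewrite subr_ge0.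
apply: (wiener_indep HW a0 ba0); last exact: mV.
move/measurable_wrt_gen : mY => /(_ E' mE').
by rewrite /sigma_generated_by subrKC.
Qed.

Lemma incr_mean i a b : 0 <= a -> 0 <= b -> \int[Pr]_w wincr i a b w = 0.
Proof.
move=> a0 b0; rewrite RintegralB//; try by apply: sqint_integrable; exact: sqint_wiener.
have := wiener_mean HW i a0; have := wiener_mean HW i b0.
by rewrite !unlock /Rintegral => -> ->; rewrite subrr.
Qed.

(** Independence factors the expectation and the increment has mean zero. V is allowed to be
    unbounded, so that it may be W(a) or contain an earlier increment. *)
Lemma incr_orth i a b V : 0 <= a -> a <= b -> measurable_wrt (F a) V ->
  sqP V -> ipP V (wincr i a b) = 0.
Proof.
move=> a0 ab mV sV; have b0 := le_trans a0 ab; have sI := sqint_incr i a0 b0.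
rewrite /ip (@incr_indepM a b)//.
- by rewrite incr_mean// mulr0.
- exact: sqint_integrable.
- exact: incr_measurable_gen.
- exact: sqint_integrable.
- exact: integrable_sqintM.
Qed.

(** The covariance is known for W at a single time only. Writing W(b) = W(a) + increment, the mixed
    terms vanish by [incr_orth], and K b = K a + (covariance of the increment). *)
Lemma incr_ip i j a b : 0 <= a -> a <= b ->
  ipP (wincr i a b) (wincr j a b) = K i j * (b - a).
Proof.
move=> a0 ab; have b0 := le_trans a0 ab.
have ipW t : 0 <= t -> ipP (fun w => W t w i 0) (fun w => W t w j 0) = K i j * t.
  by move=> t0; have := wiener_cov HW i j t0; rewrite unlock /ip /Rintegral => ->.
have sa k := sqint_wiener k a0.
have sI k := sqint_incr k a0 b0.
have o k l := incr_orth l a0 ab (wiener_wrt k a0) (sa k).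
have := ipW b b0.
have E k w : (W b w k 0 = W a w k 0 + wincr k a b w) by rewrite /wincr subrKC.
rewrite (_ : ipP _ _ = ipP (fun w => W a w i 0 + wincr i a b w)
  (fun w => W a w j 0 + wincr j a b w)); last by apply: eq_ip => w _; exact: E.
rewrite (ipDl measurableT (sa i) (sI i) (sqintD measurableT (sa j) (sI j))).
rewrite !(ipDr measurableT (sa j) (sI j)) ?ipW//.
rewrite (ipC _ _ (wincr i a b) (fun w => W a w j 0)) !o.
by rewrite addr0 add0r => H; rewrite mulrBr -H; ring.
Qed.

Lemma incr_cov i j a b V M : 0 <= a -> a <= b -> measurable_wrt (F a) V ->
  (forall w, `|V w| <= M) ->
  \int[Pr]_w (V w * (wincr i a b w * wincr j a b w)) =
  K i j * (b - a) * \int[Pr]_w V w.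
Proof.
move=> a0 ab mV VM; have b0 := le_trans a0 ab.
have sI k := sqint_incr k a0 b0.
have mV' : measurable_fun setT V by exact: filtration_measurable mV.
have sVI := sqint_boundedM mV' VM (sI i).
rewrite (@incr_indepM a b)//.
- by rewrite -incr_ip// mulrC.
- apply: sqint_integrable.
  by apply: eq_sqint (sqint_boundedM mV' VM (sqint_cst Pr 1)) => // w _; rewrite mulr1.
- by apply: measurable_funM; exact: incr_measurable_gen.
- exact: integrable_sqintM.
- have := integrable_sqintM measurableT sVI (sI j).
  by apply: eq_integrable => // w _ /=; rewrite mulrA.
Qed.

End wiener_increments.

(** * Fubini on strips *)

Lemma abse_fine_le (R : realType) (a : \bar R) : (`|(fine a)%:E| <= `|a|)%E.
Proof. by case: a => [r||] //=; rewrite normr0 leey. Qed.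

Section fubini_strip.
Context {d1 d2 : measure_display} {T1 : measurableType d1}
  {T2 : measurableType d2} {R : realType}.
Variable m1 : {sigma_finite_measure set T1 -> \bar R}.
Variable m2 : {sigma_finite_measure set T2 -> \bar R}.
Variable E : set T1.
Hypothesis mE : measurable E.

Let S : set (T1 * T2) := E `*` setT.

Lemma measurable_strip : measurable S. Proof. exact: measurableX. Qed.

(** Fubini and Tonelli are applied on the full product to f extended by zero outside the strip;
    [stripF] and [stripG] identify the partial integrals of that extension. *)
Let stripF (f : T1 * T2 -> \bar R) x :
  (\int[m2]_y (f \_ S) (x, y) =
   ((fun x => \int[m2]_y f (x, y)) \_ E) x)%E.
Proof.
rewrite patchE; case: ifPn => [/set_mem xE|/negP xE].
  apply: eq_integral => y _; rewrite patchE mem_set//.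
apply: integral0_eq => y _; rewrite patchE ifF//; apply/negbTE/negP.
by move=> /set_mem[/= /mem_set].
Qed.

Let stripG (f : T1 * T2 -> \bar R) y :
  (\int[m1]_x (f \_ S) (x, y) = \int[m1]_(x in E) f (x, y))%E.
Proof.
rewrite [RHS]integral_mkcond; apply: eq_integral => x _.
rewrite !patchE; congr (if _ then _ else _).
by apply/idP/idP => [/set_mem[/= ? _]|/set_mem ?]; rewrite inE.
Qed.

Section tonelli.
Variable f : T1 * T2 -> \bar R.
Hypotheses (mf : measurable_fun S f) (f0 : forall z, S z -> (0 <= f z)%E).

Let mfS : measurable_fun setT (f \_ S).
Proof. exact/(measurable_restrictT _ measurable_strip). Qed.

Let fS0 z : (0 <= (f \_ S) z)%E.
Proof. by rewrite patchE; case: ifPn => // /set_mem /f0. Qed.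

Lemma tonelli_strip1 :
  (\int[m1 \x m2]_(z in S) f z = \int[m1]_(x in E) \int[m2]_y f (x, y))%E.
Proof.
rewrite integral_mkcond fubini_tonelli1// [RHS]integral_mkcond.
by apply: eq_integral => x _; rewrite -stripF.
Qed.

Lemma tonelli_strip2 :
  (\int[m1 \x m2]_(z in S) f z = \int[m2]_y \int[m1]_(x in E) f (x, y))%E.
Proof.
rewrite integral_mkcond fubini_tonelli2//.
by apply: eq_integral => y _; rewrite -stripG.
Qed.

Lemma measurable_tonelli_strip1 :
  measurable_fun E (fun x => \int[m2]_y f (x, y))%E.
Proof.
apply/measurable_restrictT => //.
have := measurable_fun_fubini_tonelli_F (m2 := m2) _ mfS fS0.
by apply: eq_measurable_fun => x _; rewrite -stripF.
Qed.

Lemma measurable_tonelli_strip2 :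
  measurable_fun setT (fun y => \int[m1]_(x in E) f (x, y))%E.
Proof.
have := measurable_fun_fubini_tonelli_G (m1 := m1) _ mfS fS0.
by apply: eq_measurable_fun => y _; rewrite -stripG.
Qed.

End tonelli.

Section fubini.
Variable h : T1 * T2 -> R.
Hypothesis ih : (m1 \x m2)%E.-integrable S (EFin \o h).

Let ihS : (m1 \x m2)%E.-integrable setT ((EFin \o h) \_ S).
Proof. exact/(integrable_mkcond _ measurable_strip). Qed.

Lemma ae_integrable_strip1 :
  {ae m1, forall x, E x -> m2.-integrable setT (EFin \o (fun y => h (x, y)))}.
Proof.
have := ae_integrable1 ihS; apply: filterS => x + Ex.
apply: eq_integrable => // y _; rewrite patchE mem_set//.
Qed.

Lemma ae_integrable_strip2 :
  {ae m2, forall y, m1.-integrable E (EFin \o (fun x => h (x, y)))}.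
Proof.
have := ae_integrable2 ihS; apply: filterS => y.
move/(integrableS measurableT mE (@subsetT _ _)).
by apply: eq_integrable => // x /set_mem Ex; rewrite patchE mem_set.
Qed.

Let int1 : m1.-integrable E (fun x => \int[m2]_y (h (x, y))%:E)%E.
Proof.
apply/integrable_mkcond => //.
have := integrable_fubini_F ihS.
by apply: eq_integrable => // x _; rewrite /fubini_F stripF.
Qed.

(** The partial integral is dominated by the partial integral of |h|, which has finite total
    integral. *)
Let int2 : m2.-integrable setT (fun y => \int[m1]_(x in E) (h (x, y))%:E)%E.
Proof.
have mhS := measurable_int _ ihS.
suff : m2.-integrable setT (fubini_G m1 ((EFin \o h) \_ S)).
  by apply: eq_integrable => // y _; rewrite /fubini_G stripG.
apply/integrableP; split; first exact: (measurable_fubini_G ihS).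
apply: le_lt_trans ((integrable21ltyP m1 m2 mhS).1 ihS).
have mabs : measurable_fun setT (abse \o ((EFin \o h) \_ S)).
  exact: measurableT_comp.
apply: ge0_le_integral; [by []|by []|..].
- by apply: measurableT_comp; last exact: (measurable_fubini_G ihS).
- by apply: (measurable_fun_fubini_tonelli_G (m1 := m1) _ mabs) => z /=.
- move=> y _; apply: le_abse_integral => //.
  exact: measurableT_comp.
Qed.

Lemma integrable_strip1 :
  m1.-integrable E (EFin \o (fun x => \int[m2]_y h (x, y))).
Proof.
apply: le_integrable int1 => //.
  apply/measurable_EFinP; apply: measurableT_comp => //.
  exact: measurable_int int1.
by move=> x _; exact: abse_fine_le.
Qed.

Lemma integrable_strip2 :
  m2.-integrable setT (EFin \o (fun y => \int[m1]_(x in E) h (x, y))).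
Proof.
apply: le_integrable int2 => //.
  apply/measurable_EFinP; apply: measurableT_comp => //.
  exact: measurable_int int2.
by move=> x _; exact: abse_fine_le.
Qed.

(** The inner integral is now real-valued. It agrees with the extended one only where the section of
    h is integrable, hence almost everywhere; elsewhere [fine] may replace an infinite value by
    0. *)
Lemma fubini_strip1 :
  \int[(m1 \x m2)%E]_(z in S) h z = \int[m1]_(x in E) \int[m2]_y h (x, y).
Proof.
rewrite {1 2}/Rintegral; congr fine.
rewrite integral_mkcond -integral12_prod_meas1//.
transitivity (\int[m1]_(x in E) \int[m2]_y (h (x, y))%:E)%E.
  rewrite [RHS]integral_mkcond.
  by apply: eq_integral => x _; rewrite /fubini_F stripF.
apply: ae_eq_integral => //.
- exact: measurable_int int1.
- exact: measurable_int integrable_strip1.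
- have := ae_integrable_strip1; apply: filterS => x /[apply] ix.
  by rewrite fineK//; exact: integrable_fin_num.
Qed.

Lemma fubini_strip2 :
  \int[(m1 \x m2)%E]_(z in S) h z = \int[m2]_y \int[m1]_(x in E) h (x, y).
Proof.
rewrite {1 2}/Rintegral; congr fine.
rewrite integral_mkcond -integral21_prod_meas1//.
transitivity (\int[m2]_y \int[m1]_(x in E) (h (x, y))%:E)%E.
  by apply: eq_integral => y _; rewrite /fubini_G stripG.
apply: ae_eq_integral => //.
- exact: measurable_int int2.
- exact: measurable_int integrable_strip2.
- have := ae_integrable_strip2; apply: filterS => x ix _.
  by rewrite fineK//; exact: integrable_fin_num.
Qed.

End fubini.

End fubini_strip.

(** * Isometry and martingale property *)

Section elementary_isometry.
Context {R : realType} {d : measure_display} {Omega : measurableType d}.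
Variables (Pr : probability Omega R) (F : R -> set_system Omega).
Hypothesis HF : is_filtration Pr F.
Variables (q : nat) (K : 'M[R]_q) (W : R -> Omega -> 'cV[R]_q).
Hypothesis HW : is_wiener Pr F K W.

Local Notation ipP := (ip Pr setT).
Local Notation sqP := (sqint Pr setT).
Local Notation incr := (wincr W).

(** The length of the intersection of ]s1, s2] and ]r1, r2]. *)
Definition overlap (s1 s2 r1 r2 : R) : R :=
  Num.max 0 (Num.min s2 r2 - Num.max s1 r1).

(** Both increments are cut at c and e, the ends of the common interval. Only the product of the two
    pieces over ]c, e] has nonzero weighted mean; in every other product one factor is an increment
    starting after everything else is known. *)
Lemma incr_isometry_overlap i j (p : Omega -> R) M s1 s2 r1 r2 c e :
  measurable_wrt (F c) p -> (forall w, `|p w| <= M) ->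
  0 <= s1 -> 0 <= r1 -> c = Num.max s1 r1 -> e = Num.min s2 r2 -> c <= e ->
  \int[Pr]_w (p w * (incr i s1 s2 w * incr j r1 r2 w)) =
  K i j * (e - c) * \int[Pr]_w p w.
Proof.
move=> mp pM s10 r10 cE eE ce.
have s1c : s1 <= c by rewrite cE le_max lexx.
have r1c : r1 <= c by rewrite cE le_max lexx orbT.
have es2 : e <= s2 by rewrite eE ge_min lexx.
have er2 : e <= r2 by rewrite eE ge_min lexx orbT.
have c0 : 0 <= c by exact: le_trans s1c.
have e0 : 0 <= e by exact: le_trans ce.
have s20 : 0 <= s2 by exact: le_trans es2.
have r20 : 0 <= r2 by exact: le_trans er2.
have mp' := filtration_measurable HF c0 mp.
have sI k a b (a0 : 0 <= a) (b0 : 0 <= b) := sqint_incr HF HW k a0 b0.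
have spI k a b (a0 : 0 <= a) (b0 : 0 <= b) := sqint_boundedM mp' pM (sI k a b a0 b0).
have mpI t k a b : c <= t -> 0 <= a -> a <= t -> 0 <= b -> b <= t ->
    measurable_wrt (F t) (fun w => p w * incr k a b w).
  move=> ct a0 at_ b0 bt; have t0 := le_trans c0 ct.
  apply: measurable_wrtM; first exact: filtration_sigma_algebra HF _ t0.
    exact: filtration_le HF _ _ _ c0 ct mp.
  exact: (incr_wrt HF HW).
have O t k l a b z : c <= t -> 0 <= a -> a <= t -> 0 <= b -> b <= t -> t <= z ->
    \int[Pr]_w (p w * incr k a b w * incr l t z w) = 0.
  move=> ct a0 at_ b0 bt tz; have t0 := le_trans c0 ct.
  by apply: (incr_orth HF HW) => //; [exact: mpI|exact: spI].
have iI k l a b a' b' : 0 <= a -> 0 <= b -> 0 <= a' -> 0 <= b' ->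
    Pr.-integrable setT (EFin \o (fun w => p w * incr k a b w * incr l a' b' w)).
  by move=> *; apply: integrable_sqintM => //; [exact: spI|exact: sI].
(* Five products suffice: one of s1, r1 equals c and one of s2, r2 equals e, so that the products of
   two pieces before c, or of two pieces after e, are zero. *)
have E w : p w * (incr i s1 s2 w * incr j r1 r2 w) =
    p w * incr i s1 c w * incr j c r2 w + (p w * incr j r1 c w * incr i c s2 w
    + (p w * incr i c e w * incr j e r2 w + (p w * incr j c e w * incr i e s2 w
    + p w * (incr i c e w * incr j c e w)))).
  have [/eqP ac|/eqP ac] : s1 == c \/ r1 == c.
    by rewrite cE; case: (leP s1 r1) => _; [right|left].
  - have [/eqP be|/eqP be] : s2 == e \/ r2 == e.
      by rewrite eE; case: (leP s2 r2) => _; [left|right].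
    + by rewrite ac be /wincr; ring.
    + by rewrite ac be /wincr; ring.
  - have [/eqP be|/eqP be] : s2 == e \/ r2 == e.
      by rewrite eE; case: (leP s2 r2) => _; [left|right].
    + by rewrite ac be /wincr; ring.
    + by rewrite ac be /wincr; ring.
rewrite (eq_Rintegral _ (fun w _ => E w)).
have i5 : Pr.-integrable setT (EFin \o (fun w => p w * (incr i c e w * incr j c e w))).
  by apply: eq_integrable (iI i j c e c e c0 e0 c0 e0) => // w _ /=; rewrite mulrA.
have i4 := iI j i c e e s2 c0 e0 e0 s20.
have i3 := iI i j c e e r2 c0 e0 e0 r20.
have i2 := iI j i r1 c c s2 r10 c0 c0 s20.
have i1 := iI i j s1 c c r2 s10 c0 c0 r20.
have i45 := integrableD measurableT i4 i5.
have i35 := integrableD measurableT i3 i45.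
have i25 := integrableD measurableT i2 i35.
rewrite RintegralD//= RintegralD//= RintegralD//= RintegralD//=.
have cs2 := le_trans ce es2; have cr2 := le_trans ce er2.
by rewrite !O// !add0r (incr_cov HF HW i j c0 ce mp pM).
Qed.

(* Measurability of xi is only required when s1 < s2: truncating the partition
   of a simple process at time t may produce degenerate intervals ]t, t]. *)
Lemma elementary_isometry i j (xi eta : Omega -> R) M M' s1 s2 r1 r2 :
  measurable_fun setT xi -> measurable_fun setT eta ->
  (s1 < s2 -> measurable_wrt (F s1) xi) -> (r1 < r2 -> measurable_wrt (F r1) eta) ->
  (forall w, `|xi w| <= M) -> (forall w, `|eta w| <= M') ->
  0 <= s1 -> s1 <= s2 -> 0 <= r1 -> r1 <= r2 ->
  ipP (fun w => xi w * incr i s1 s2 w) (fun w => eta w * incr j r1 r2 w) =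
  K i j * overlap s1 s2 r1 r2 * ipP xi eta.
Proof.
move=> mxi meta axi aeta bxi beta s10 s12 r10 r12.
have s20 := le_trans s10 s12; have r20 := le_trans r10 r12.
have sI k a b (a0 : 0 <= a) (b0 : 0 <= b) := sqint_incr HF HW k a0 b0.
have ip0 (f g : Omega -> R) : (forall w, f w * g w = 0) -> ipP f g = 0.
  move=> fg; rewrite /ip (@eq_Rintegral _ _ _ _ _ (fun=> 0)).
    by rewrite Rintegral_cst// mul0r.
  by move=> w _.
have sigma t : 0 <= t -> sigma_algebra setT (F t) by exact: filtration_sigma_algebra HF _.
have bM w : `|xi w * eta w| <= M * M' by rewrite normrM ler_pM.
have mM : measurable_fun setT (fun w => xi w * eta w) by exact: measurable_funM.
have [E|s12'] := eqVneq s1 s2.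
  rewrite ip0 => [|w]; last by rewrite /wincr E subrr mulr0 mul0r.
  suff -> : overlap s1 s2 r1 r2 = 0 by rewrite mulr0 mul0r.
  rewrite /overlap max_l// E subr_le0.
  by rewrite (@le_trans _ _ s2)// ?ge_min ?le_max lexx.
have [E|r12'] := eqVneq r1 r2.
  rewrite ip0 => [|w]; last by rewrite /wincr E subrr !mulr0.
  suff -> : overlap s1 s2 r1 r2 = 0 by rewrite mulr0 mul0r.
  rewrite /overlap max_l// E subr_le0.
  by rewrite (@le_trans _ _ r2)// ?ge_min ?le_max lexx orbT.
have {}axi : measurable_wrt (F s1) xi by apply: axi; rewrite lt_neqAle s12'.
have {}aeta : measurable_wrt (F r1) eta by apply: aeta; rewrite lt_neqAle r12'.
(* For disjoint intervals, both coefficients and the earlier increment are known when the later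
   increment starts, and [incr_orth] applies. *)
have [sr|rs2] := leP s2 r1.
  rewrite (_ : overlap _ _ _ _ = 0) ?mulr0 ?mul0r; last first.
    rewrite /overlap max_l// subr_le0.
    by rewrite (@le_trans _ _ s2)// ?ge_min ?le_max ?lexx ?sr ?orbT.
  rewrite -[RHS](incr_orth HF HW j r10 r12 (V := fun w => xi w * eta w * incr i s1 s2 w)).
  - by apply: eq_Rintegral => w _; ring.
  - apply: measurable_wrtM; first exact: sigma.
      apply: measurable_wrtM => //; first exact: sigma.
      by apply: (filtration_le HF s10 _ axi); exact: le_trans sr.
    by apply: (incr_wrt HF HW) => //; exact: le_trans sr.
  - by apply: (sqint_boundedM mM bM); exact: sI.
have [rs|sr2] := leP r2 s1.
  rewrite (_ : overlap _ _ _ _ = 0) ?mulr0 ?mul0r; last first.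
    rewrite /overlap max_l// subr_le0.
    by rewrite (@le_trans _ _ r2)// ?ge_min ?le_max ?lexx ?rs ?orbT.
  rewrite -[RHS](incr_orth HF HW i s10 s12 (V := fun w => xi w * eta w * incr j r1 r2 w)).
  - by apply: eq_Rintegral => w _; ring.
  - apply: measurable_wrtM; first exact: sigma.
      apply: measurable_wrtM => //; first exact: sigma.
      by apply: (filtration_le HF r10 _ aeta); exact: le_trans rs.
    by apply: (incr_wrt HF HW) => //; exact: le_trans rs.
  - by apply: (sqint_boundedM mM bM); exact: sI.
pose c := Num.max s1 r1; pose e := Num.min s2 r2.
have ce : c <= e.
  by rewrite /c /e ge_max !le_min s12 r12 !ltW.
have c0 : 0 <= c by rewrite le_max s10.
rewrite /overlap max_r ?subr_ge0//.
transitivity (\int[Pr]_w (xi w * eta w * (incr i s1 s2 w * incr j r1 r2 w))).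
  by apply: eq_Rintegral => w _; ring.
apply: (@incr_isometry_overlap i j _ (M * M') s1 s2 r1 r2 c e) => //.
apply: measurable_wrtM; first exact: sigma.
- by apply: (filtration_le HF s10 _ axi); rewrite le_max lexx.
- by apply: (filtration_le HF r10 _ aeta); rewrite le_max lexx orbT.
Qed.

End elementary_isometry.

(** * Square-integrable functions on [0, t] x Omega *)

Section time_strip.
Context {R : realType} {d : measure_display} {Omega : measurableType d}.
Variable Pr : probability Omega R.

Local Notation mu := (@lebesgue_measure R).

(* The Lebesgue measure lives on [measurableTypeR R], whose measure display is
   not that of [R]; products with Omega have to be taken over the former. *)
Local Notation RT := (measurableTypeR R).

Definition strip (T : \bar R) : set (RT * Omega) := times T `*` setT.

Lemma timesE (t : R) : times t%:E = `[0, t]%classic.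
Proof.
apply/seteqP; split => s; rewrite /times /= in_itv/= lee_fin.
  by move=> [-> ->].
by move=> /andP[].
Qed.

Lemma timesy : times +oo%E = `[0, +oo[%classic :> set R.
Proof.
apply/seteqP; split => s; rewrite /times /= in_itv/= andbT.
  by case.
by move=> s0; split => //; exact: leey.
Qed.

Lemma measurable_times (T : \bar R) : measurable (times T : set (measurableTypeR R)).
Proof.
case: T => [t||]; first by rewrite timesE.
  by rewrite timesy.
rewrite (_ : times -oo%E = set0)//.
by apply/seteqP; split => s // -[_]; rewrite leeNy_eq.
Qed.

Lemma measurable_time_strip T : measurable (strip T).
Proof. by apply: measurableX => //; exact: measurable_times. Qed.

Lemma mu_times (t : R) : 0 <= t -> mu (times t%:E) = t%:E.
Proof.
move=> t0; rewrite timesE lebesgue_measure_itv/= lte_fin.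
have [|t0'] := ltP 0 t; first by rewrite sube0.
by congr EFin; apply/le_anti; rewrite t0 t0'.
Qed.

Lemma times_le (s : R) T : times T s -> times s%:E `<=` times T.
Proof.
move=> [_ sT] r [r0 rs]; split => //; exact: le_trans sT.
Qed.

Lemma strip_le (s : R) T : times T s -> strip s%:E `<=` strip T.
Proof. by move=> sT z [z1 _]; split => //; exact: times_le z1. Qed.

Local Notation muP := (mu \x Pr)%E.

Local Notation ipP := (ip Pr setT).
Local Notation sqP := (sqint Pr setT).

Section finite_horizon.
Variable t : R.
Hypothesis t0 : 0 <= t.

Local Notation ipD := (ip muP (strip t%:E)).
Local Notation sqD := (sqint muP (strip t%:E)).

(** Lets a variable at the final time be tested against processes, as a process constant in time. *)
Lemma sqint_snd f : sqP f -> sqD (fun z => f z.2).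
Proof.
move=> [mf f2]; split.
  by apply: measurable_funTS; exact: measurableT_comp.
rewrite tonelli_strip1/=.
- rewrite integral_cst; last exact: measurable_times.
  have f20 : (0 <= \int[Pr]_w ((f w) ^+ 2)%:E)%E.
    by apply: integral_ge0 => w _; rewrite lee_fin sqr_ge0.
  rewrite [X in (_ * X)%E](_ : _ = t%:E); last exact: mu_times.
  by rewrite lte_mul_pinfty ?ltry// ge0_fin_numE.
- exact: measurable_times.
- apply: measurable_funTS; apply/measurable_EFinP; apply: measurable_funX.
  exact: measurableT_comp.
- by move=> z _; rewrite lee_fin sqr_ge0.
Qed.

Lemma ip_strip1 f g : sqD f -> sqD g ->
  ipD f g = \int[mu]_(s in times t%:E) \int[Pr]_w (f (s, w) * g (s, w)).
Proof.
move=> sf sg; exact: (fubini_strip1 (measurable_times _)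
  (integrable_sqintM (measurable_time_strip _) sf sg)).
Qed.

Lemma ip_strip2 f g : sqD f -> sqD g ->
  ipD f g = \int[Pr]_w \int[mu]_(s in times t%:E) (f (s, w) * g (s, w)).
Proof.
move=> sf sg; exact: (fubini_strip2 (measurable_times _)
  (integrable_sqintM (measurable_time_strip _) sf sg)).
Qed.

End finite_horizon.

Section indicators.
Variable t : R.
Hypothesis t0 : 0 <= t.
Local Notation ipD := (ip muP (strip t%:E)).
Local Notation sqD := (sqint muP (strip t%:E)).

(** One summand of [sp_fun], as a function on the strip. *)
Definition elem (xi : Omega -> R) (a b : R) (z : RT * Omega) : R :=
  xi z.2 * (a < z.1 <= b)%R%:R.

Lemma measurable_elem xi a b D : measurable_fun setT xi ->
  measurable_fun D (elem xi a b).
Proof.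
move=> mxi; apply: measurable_funTS; apply: measurable_funM.
  exact: measurableT_comp.
have -> : (fun z : R * Omega => (a < z.1 <= b)%R%:R) =
    (\1_(`]a, b]%classic) \o fst) :> (RT * Omega -> R).
  apply/funext => z /=; rewrite indicE; congr ((nat_of_bool _)%:R).
  by rewrite mem_setE in_itv.
by apply: measurableT_comp => //; exact: measurable_indic.
Qed.

Lemma sqint_elem (xi : Omega -> R) M a b : measurable_fun setT xi ->
  (forall w, `|xi w| <= M) -> sqD (elem xi a b).
Proof.
move=> mxi xiM; have sx : sqP xi.
  by apply: eq_sqint (sqint_boundedM mxi xiM (sqint_cst Pr 1)) => // w _; rewrite mulr1.
apply: (le_sqint (measurable_time_strip _)) (sqint_snd t0 sx) _.
  exact: measurable_elem.
move=> z _; rewrite normrM ler_piMr// normr_nat lern1.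
by case: (_ < _ <= _).
Qed.

Lemma mu_itv_oc (a b : R) : mu `]a, b]%classic = (Num.max 0 (b - a))%:E.
Proof.
rewrite lebesgue_measure_itv/= lte_fin.
case: ltP => h; last by rewrite max_l// subr_le0.
by rewrite max_r// subr_ge0 ltW.
Qed.

(** The ends are truncated at t exactly as the times in [sp_integral] are; 0 <= s1 keeps the
    intersection inside the nonnegative times. *)
Lemma overlap_integral (s1 s2 r1 r2 : R) : 0 <= s1 ->
  \int[mu]_(s in times t%:E) ((s1 < s <= s2)%R%:R * (r1 < s <= r2)%R%:R) =
  overlap (Num.min s1 t) (Num.min s2 t) (Num.min r1 t) (Num.min r2 t).
Proof.
move=> s10; transitivity (\int[mu]_(s in times t%:E)
    (\1_(`]Num.max s1 r1, Num.min s2 r2]%classic) s)).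
  apply: eq_Rintegral => s _; rewrite indicE mem_setE in_itv/= gt_max le_min -natrM mulnb.
  by congr ((nat_of_bool _)%:R); do 4 case: (_ < _) || case: (_ <= _).
rewrite /Rintegral integral_indic//; last exact: measurable_times.
rewrite (_ : _ `&` _ = `]Num.max (Num.min s1 t) (Num.min r1 t),
     Num.min (Num.min s2 t) (Num.min r2 t)]%classic); last first.
  rewrite timesE; apply/seteqP; split => s; rewrite /= !in_itv/= !gt_max !le_min !gt_min.
    by move=> [/andP[/andP[-> ->]] /andP[-> ->] /andP[_ ->]].
  move=> /andP[/andP[a b] /andP[/andP[-> st] /andP[-> _]]].
  rewrite st andbT; split.
    by move: a b; rewrite !(ltNge t s) st !orbF => -> ->.
  move: a; rewrite (ltNge t s) st orbF => a.
  by rewrite (le_trans s10)// ltW.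
exact: (congr1 fine (mu_itv_oc _ _)).
Qed.

(** The same expression as in [elementary_isometry] for the truncated intervals, up to the factor K
    i j; the isometry for simple processes is a comparison of the two. *)
Lemma ip_elem (xi eta : Omega -> R) M M' s1 s2 r1 r2 : measurable_fun setT xi ->
  measurable_fun setT eta -> (forall w, `|xi w| <= M) ->
  (forall w, `|eta w| <= M') -> 0 <= s1 ->
  ipD (elem xi s1 s2) (elem eta r1 r2) =
  overlap (Num.min s1 t) (Num.min s2 t) (Num.min r1 t) (Num.min r2 t)
  * ipP xi eta.
Proof.
move=> mxi meta xiM etaM s10.
have sx : sqP xi.
  by apply: eq_sqint (sqint_boundedM mxi xiM (sqint_cst Pr 1)) => // w _; rewrite mulr1.
have se : sqP eta.
  by apply: eq_sqint (sqint_boundedM meta etaM (sqint_cst Pr 1)) => // w _; rewrite mulr1.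
rewrite ip_strip1//; [|exact: sqint_elem xiM|exact: sqint_elem etaM].
rewrite -overlap_integral// -RintegralZr.
- apply: eq_Rintegral => s _; rewrite /elem/=.
  rewrite -RintegralZl//; last exact: integrable_sqintM.
  by apply: eq_Rintegral => w _; ring.
- exact: measurable_times.
- have fin : (mu (times t%:E) < +oo)%E by rewrite mu_times// ltry.
  apply: measurable_bounded_integrable => //; first exact: measurable_times.
    apply: measurable_funTS; apply: measurable_funM.
      have -> : (fun z => (s1 < z <= s2)%R%:R) = \1_(`]s1, s2]%classic) :> (R -> R).
        by apply/funext => z /=; rewrite indicE mem_setE in_itv.
      exact: measurable_indic.
    have -> : (fun z => (r1 < z <= r2)%R%:R) = \1_(`]r1, r2]%classic) :> (R -> R).
      by apply/funext => z /=; rewrite indicE mem_setE in_itv.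
    exact: measurable_indic.
  exists 1; split => // x x1 s _; rewrite /= -natrM mulnb normr_nat.
  by rewrite (le_trans _ (ltW x1))// lern1; case: (_ && _).
Qed.

End indicators.

End time_strip.

Section ae_inner_product.
Context {d : measure_display} {T : measurableType d} {R : realType}.
Variables (m : {measure set T -> \bar R}).

Lemma ae_eq_ip (f f' g : T -> R) : sqint m setT f -> sqint m setT f' ->
  sqint m setT g -> {ae m, forall x, f x = f' x} -> ip m setT f g = ip m setT f' g.
Proof.
move=> sf sf' sg ff'; rewrite /ip /Rintegral; congr fine.
apply: ae_eq_integral => //.
- exact: measurable_int (integrable_sqintM measurableT sf sg).
- exact: measurable_int (integrable_sqintM measurableT sf' sg).
- by apply: filterS ff' => x -> _.
Qed.

Lemma ae_eq_sqint (f f' : T -> R) : measurable_fun setT f' -> sqint m setT f ->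
  {ae m, forall x, f x = f' x} -> sqint m setT f'.
Proof.
move=> mf' [mf f2] ff'; split => //; move: f2; apply: le_lt_trans.
rewrite le_eqVlt; apply/orP; left; apply/eqP.
apply: ae_eq_integral => //.
- by apply/measurable_EFinP; exact: measurable_funX.
- by apply/measurable_EFinP; exact: measurable_funX.
- by apply: filterS ff' => x -> _.
Qed.

End ae_inner_product.

Lemma cvgL2_subset (d : measure_display) (T : measurableType d) (R : realType)
    (m : {measure set T -> \bar R}) (D E : set T) (u : nat -> T -> R) f :
  measurable D -> measurable E -> D `<=` E ->
  (forall k, measurable_fun E (u k)) -> measurable_fun E f ->
  cvgL2 m E u f -> cvgL2 m D u f.
Proof.
move=> mD mE DE mu mf uf.
apply: (squeeze_cvge _ (cvg_cst 0%E) uf); apply: nearW => k.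
apply/andP; split; first by apply: integral_ge0 => x _; rewrite lee_fin sqr_ge0.
apply: ge0_subset_integral => //.
  apply/measurable_EFinP; apply: measurable_funX.
  exact: measurable_funB.
by move=> x _; rewrite lee_fin sqr_ge0.
Qed.

(** * Isometry and martingale property of the Ito integral *)

Section ito_integral.
Context {R : realType} {d : measure_display} {Omega : measurableType d}.
Variables (Pr : probability Omega R) (F : R -> set_system Omega).
Hypothesis HF : is_filtration Pr F.
Variables (q : nat) (K : 'M[R]_q) (W : R -> Omega -> 'cV[R]_q).
Hypothesis HW : is_wiener Pr F K W.

Local Notation mu := (@lebesgue_measure R).
Local Notation RT := (measurableTypeR R).
Local Notation muP := (mu \x Pr)%E.
Local Notation ipP := (ip Pr setT).
Local Notation sqP := (sqint Pr setT).
Local Notation ipD t := (ip muP (strip t%:E)).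
Local Notation sqD t := (sqint muP (strip t%:E)).
Local Notation incr := (wincr W).
Local Notation beta i := (fun s w => W s w i 0).

Definition uncurry_process (f : R -> Omega -> R) : RT * Omega -> R :=
  fun z => f z.1 z.2.

Local Notation spf phi := (uncurry_process (sp_fun phi)).

Lemma sp_time_nonneg (phi : simple_process F) j : 0 <= sp_time phi j.
Proof.
elim: j => [|j ih]; first exact: sp_time_ge0.
by rewrite (le_trans ih)// sp_time_nondecreasing.
Qed.

Lemma sp_val_measurableT (phi : simple_process F) j :
  measurable_fun setT (sp_val phi j).
Proof.
apply: (filtration_measurable HF (sp_time_nonneg phi j)).
exact: sp_val_measurable.
Qed.

Lemma min_ge0 (a t : R) : 0 <= a -> 0 <= t -> 0 <= Num.min a t.
Proof. by move=> a0 t0; rewrite le_min a0. Qed.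

Lemma sqint_sp_term (phi : simple_process F) i j t : 0 <= t ->
  sqP (fun w => sp_val phi j w *
         incr i (Num.min (sp_time phi j) t) (Num.min (sp_time phi j.+1) t) w).
Proof.
move=> t0; have [M bM] := sp_val_bounded phi j.
apply: (sqint_boundedM (sp_val_measurableT phi j) bM).
by apply: (sqint_incr HF HW); apply: min_ge0 => //; exact: sp_time_nonneg.
Qed.

Lemma sqint_sp_integral (phi : simple_process F) i t : 0 <= t ->
  sqP (sp_integral (beta i) phi t).
Proof.
move=> t0; apply: (sqint_sum measurableT) => j.
exact: sqint_sp_term.
Qed.

Lemma sqint_sp_elem (phi : simple_process F) j t : 0 <= t ->
  sqD t (elem (sp_val phi j) (sp_time phi j) (sp_time phi j.+1)).
Proof.
move=> t0; have [M bM] := sp_val_bounded phi j.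
by apply: sqint_elem bM => //; exact: sp_val_measurableT.
Qed.

Lemma sqint_sp_fun (phi : simple_process F) t : 0 <= t -> sqD t (spf phi).
Proof.
move=> t0; apply: (sqint_sum (measurable_time_strip _)) => j.
exact: sqint_sp_elem.
Qed.

Lemma measurable_sp_fun (phi : simple_process F) (D : set (RT * Omega)) :
  measurable_fun D (spf phi).
Proof.
apply: measurable_sum => j.
apply: measurable_elem; exact: sp_val_measurableT.
Qed.

Lemma sp_isometry (phi psi : simple_process F) i j t : 0 <= t ->
  ipP (sp_integral (beta i) phi t) (sp_integral (beta j) psi t) =
  K i j * ipD t (spf phi) (spf psi).
Proof.
move=> t0.
transitivity (\sum_(k < sp_len phi) \sum_(l < sp_len psi)
    K i j * ipD t (elem (sp_val phi k) (sp_time phi k) (sp_time phi k.+1))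
      (elem (sp_val psi l) (sp_time psi l) (sp_time psi l.+1))); last first.
  rewrite (ip_suml (measurable_time_strip _)); last 2 first.
  - by move=> k; exact: sqint_sp_elem.
  - exact: sqint_sp_fun.
  rewrite mulr_sumr; apply: eq_bigr => k _.
  rewrite (ip_sumr (measurable_time_strip _)) ?mulr_sumr//.
  - by move=> l; exact: sqint_sp_elem.
  - exact: sqint_sp_elem.
rewrite (ip_suml measurableT); last 2 first.
- by move=> k; exact: sqint_sp_term.
- exact: sqint_sp_integral.
apply: eq_bigr => k _.
rewrite (ip_sumr measurableT); last 2 first.
- by move=> l; exact: sqint_sp_term.
- exact: sqint_sp_term.
apply: eq_bigr => l _.
have [M bM] := sp_val_bounded phi k; have [M' bM'] := sp_val_bounded psi l.
have mx := sp_val_measurableT phi k; have my := sp_val_measurableT psi l.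
(* A nondegenerate truncated interval starts at the original partition point, where the coefficient
   is known. *)
have wrt (f : simple_process F) n :
    Num.min (sp_time f n) t < Num.min (sp_time f n.+1) t ->
    measurable_wrt (F (Num.min (sp_time f n) t)) (sp_val f n).
  case: (leP (sp_time f n) t) => [_ _|tn]; first exact: sp_val_measurable.
  by rewrite lt_min ltxx andbF.
have mono (f : simple_process F) n :
    Num.min (sp_time f n) t <= Num.min (sp_time f n.+1) t.
  by rewrite le_min !ge_min sp_time_nondecreasing lexx orbT.
rewrite (elementary_isometry HF HW i j mx my _ _ bM bM')//; try exact: wrt.
- rewrite (ip_elem _ t0 _ _ _ mx my bM bM') ?mulrA//; exact: sp_time_nonneg.
- exact: min_ge0 (sp_time_nonneg _ _) t0.
- exact: min_ge0 (sp_time_nonneg _ _) t0.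
Qed.

(** Between s and t, each summand changes by its coefficient times an increment that starts after s.
    Coefficient times Y is known at that start, so [incr_orth] removes the change. *)
Lemma sp_martingale (phi : simple_process F) i s t (Y : Omega -> R) :
  0 <= s -> s <= t -> measurable_wrt (F s) Y -> sqP Y ->
  ipP (sp_integral (beta i) phi t) Y = ipP (sp_integral (beta i) phi s) Y.
Proof.
move=> s0 st mY sY; have t0 := le_trans s0 st.
rewrite !(ip_suml measurableT)//; try by move=> j; exact: sqint_sp_term.
apply: eq_bigr => j _.
have [M bM] := sp_val_bounded phi j; have mx := sp_val_measurableT phi j.
set a := sp_time phi j; set b := sp_time phi j.+1.
have a0 : 0 <= a by exact: sp_time_nonneg.
have ab : a <= b by exact: sp_time_nondecreasing.
(* Ends of the intersection of ]a, b] and ]s, t]. The inner maximum makes the interval degenerate, c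
   = e = s, when b <= s; the case t < c means t < a, and then both summands vanish. *)
pose c := Num.max a s; pose e := Num.min (Num.max b s) t.
apply/eqP; rewrite -subr_eq0; apply/eqP.
rewrite -(ipBl measurableT)//; try exact: sqint_sp_term.
have sxY := sqint_boundedM mx bM sY.
have [ct|tc] := leP c t; last first.
  rewrite -[RHS](ip0l Pr measurableT Y); apply: eq_ip => // w _.
  have ta : t <= a.
    by move: tc; rewrite /c lt_max => /orP[/ltW//|]; rewrite ltNge st.
  have tb := le_trans ta ab; have sa := le_trans st ta; have sb := le_trans st tb.
  by rewrite /wincr !min_r//; ring.
have c0 : 0 <= c by rewrite le_max a0.
have ce : c <= e.
  by rewrite le_min ct andbT /c ge_max !le_max ab lexx orbT.
rewrite -[RHS](incr_orth HF HW i c0 ce (V := fun w => sp_val phi j w * Y w))//.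
- apply: eq_Rintegral => w _; rewrite /wincr.
  have [sa|sa] := orP (le_total s a).
    have sb := le_trans sa ab.
    rewrite (min_r sa) (min_r sb) /e (max_l sb) /c (max_l sa).
    have a_t : a <= t by rewrite (le_trans _ ct)// le_max lexx.
    by rewrite (min_l a_t); ring.
  rewrite (min_l (le_trans sa st)) (min_l sa) /c (max_r sa).
  have [sb|sb] := orP (le_total s b).
    by rewrite (min_r sb) /e (max_l sb); ring.
  rewrite (min_l (le_trans sb st)) (min_l sb) /e (max_r sb) (min_l st); ring.
- apply: measurable_wrtM; first exact: filtration_sigma_algebra HF _ c0.
    apply: (filtration_le HF a0); first by rewrite le_max lexx.
    exact: sp_val_measurable.
  by apply: (filtration_le HF s0) mY; rewrite le_max lexx orbT.
Qed.

Section limit.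
Variables (i : 'I_q) (f : R -> Omega -> R) (t : R) (Z : Omega -> R).
Hypothesis t0 : 0 <= t.
Hypothesis mf : measurable_fun (strip t%:E) (uncurry_process f).
Hypothesis itoZ : is_ito_integral Pr F (beta i) f t Z.

(** Tonelli restates the first limit of [is_ito_integral] over the product measure. Square
    integrability of the integrand and of the integral is a consequence of the two limits. *)
Lemma ito_approx : exists phi : nat -> simple_process F,
  [/\ cvgL2 muP (strip t%:E) (fun k => spf (phi k)) (uncurry_process f),
      cvgL2 Pr setT (fun k => sp_integral (beta i) (phi k) t) Z,
      sqD t (uncurry_process f) & sqP Z].
Proof.
have [mZ [phi [cf cZ]]] := itoZ; exists phi.
have cf' : cvgL2 muP (strip t%:E) (fun k => spf (phi k)) (uncurry_process f).
  rewrite /cvgL2; have -> // : (fun k => \int[muP]_(z in strip t%:E)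
      ((spf (phi k) z - uncurry_process f z) ^+ 2)%:E)%E =
      (fun k => \int[Pr]_w \int[mu]_(s in times t%:E)
       ((sp_fun (phi k) s w - f s w) ^+ 2)%:E)%E.
  apply/funext => k; rewrite tonelli_strip2//; first exact: measurable_times.
    apply/measurable_EFinP; apply: measurable_funX; apply: measurable_funB => //.
    exact: measurable_sp_fun.
  by move=> z _; rewrite lee_fin sqr_ge0.
split => //.
- apply: (cvgL2_sqint (measurable_time_strip _) _ cf') => // k.
  exact: sqint_sp_fun.
- apply: (cvgL2_sqint measurableT _ cZ) => // k.
  exact: sqint_sp_integral.
Qed.

Lemma sqint_ito : sqP Z.
Proof. by have [phi []] := ito_approx. Qed.

(** For a simple process the martingale property leads back to time 0, where all truncated
    increments are zero; the mean passes to the limit. *)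
Lemma ito_mean : ipP Z (fun=> 1) = 0.
Proof.
have [phi [cf cZ sf sZ]] := ito_approx.
have sY : sqP (fun=> 1) by exact: sqint_cst.
have c1 := ip_cvg measurableT (fun k => sqint_sp_integral (phi k) i t0) (fun=> sY)
  sZ sY cZ (@cvgL2_cst _ _ _ _ _ _).
rewrite -(cvg_lim (@Rhausdorff R) c1); apply: cvg_lim => //.
rewrite (_ : (fun k => _) = (fun=> 0 : R)); first exact: cvg_cst.
apply/funext => k.
rewrite (sp_martingale (phi k) i (lexx 0) t0 (measurable_wrt_cst 1 _))//; last first.
  exact: filtration_sigma_algebra HF _ _.
rewrite -[RHS](ip0l Pr measurableT (fun=> 1)); apply: eq_ip => // w _.
rewrite /sp_integral big1// => j _.
by rewrite !min_r ?sp_time_nonneg// subrr mulr0.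
Qed.

End limit.

(** The polarized form is proved directly: both inner products are continuous along the two
    approximating sequences, which need not be related. *)
Lemma ito_isometry i j f g t Z Z' : 0 <= t ->
  measurable_fun (strip t%:E) (uncurry_process f) ->
  measurable_fun (strip t%:E) (uncurry_process g) ->
  is_ito_integral Pr F (beta i) f t Z ->
  is_ito_integral Pr F (beta j) g t Z' ->
  ipP Z Z' = K i j * ipD t (uncurry_process f) (uncurry_process g).
Proof.
move=> t0 mf mg iZ iZ'.
have [phi [cf cZ sf sZ]] := ito_approx t0 mf iZ.
have [psi [cg cZ' sg sZ']] := ito_approx t0 mg iZ'.
have c1 := ip_cvg measurableT (fun k => sqint_sp_integral (phi k) i t0)
  (fun k => sqint_sp_integral (psi k) j t0) sZ sZ' cZ cZ'.
have c2 := ip_cvg (measurable_time_strip _) (fun k => sqint_sp_fun (phi k) t0)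
  (fun k => sqint_sp_fun (psi k) t0) sf sg cf cg.
rewrite -(cvg_lim (@Rhausdorff R) c1); apply: cvg_lim => //.
rewrite (_ : (fun k => _) = (fun k => K i j * ipD t (spf (phi k)) (spf (psi k)))).
  by apply: cvgM => //; exact: cvg_cst.
by apply/funext => k; exact: sp_isometry.
Qed.

(** Let phi_k approximate on [0, t] and psi_k on [0, s]. Both converge to f on [0, s], hence their
    integrals up to s have vanishing distance by the isometry, and E Z Y = lim E I_t(phi_k) Y = lim
    E I_s(phi_k) Y = lim E I_s(psi_k) Y = E Z' Y. *)
Lemma ito_martingale i f s t Z Z' (Y : Omega -> R) : 0 <= s -> s <= t ->
  measurable_fun (strip t%:E) (uncurry_process f) ->
  is_ito_integral Pr F (beta i) f t Z ->
  is_ito_integral Pr F (beta i) f s Z' ->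
  measurable_wrt (F s) Y -> sqP Y -> ipP Z Y = ipP Z' Y.
Proof.
move=> s0 st mf iZ iZ' mY sY; have t0 := le_trans s0 st.
have sub : strip (Omega := Omega) s%:E `<=` strip t%:E.
  by apply: strip_le; split => //; rewrite lee_fin.
have mf' : measurable_fun (strip s%:E) (uncurry_process f).
  by apply: measurable_funS mf => //; exact: measurable_time_strip.
have [phi [cf cZ sf sZ]] := ito_approx t0 mf iZ.
have [psi [cg cZ' sg sZ']] := ito_approx s0 mf' iZ'.
have cf' : cvgL2 muP (strip s%:E) (fun k => spf (phi k)) (uncurry_process f).
  apply: cvgL2_subset cf => //; try exact: measurable_time_strip.
  by move=> k; exact: measurable_sp_fun.
have spI k := sqint_sp_fun (phi k) s0; have ssI k := sqint_sp_fun (psi k) s0.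
have sI k := sqint_sp_integral (phi k) i s0.
have sJ k := sqint_sp_integral (psi k) i s0.
pose X k w := sp_integral (beta i) (phi k) s w - sp_integral (beta i) (psi k) s w.
have sX k : sqP (X k) by exact: sqintB.
have mS := measurable_time_strip (Omega := Omega) s%:E.
(* The square is expanded before the isometry is used, which avoids a common partition for phi_k -
   psi_k. The three inner products have the same limit l, and l - 2 l + l = 0. *)
have X0 : (fun k => ipP (X k) (X k)) @ \oo --> (0 : R).
  have c1 := ip_cvg mS spI spI sg sg cf' cf'.
  have c2 := ip_cvg mS spI ssI sg sg cf' cg.
  have c3 := ip_cvg mS ssI ssI sg sg cg cg.
  have c4 := cvgM (cvg_cst (K i i)) (cvgD (cvgB c1 (cvgD c2 c2)) c3).
  rewrite (_ : (fun k => _) = (fun k => K i i * (ipD s (spf (phi k)) (spf (phi k))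
      - (ipD s (spf (phi k)) (spf (psi k)) + ipD s (spf (phi k)) (spf (psi k)))
      + ipD s (spf (psi k)) (spf (psi k))))); last first.
    apply/funext => k; rewrite /X (ipBl measurableT (sI k) (sJ k) (sX k)).
    rewrite !(ipBr measurableT (sI k) (sJ k))// !sp_isometry//.
    by rewrite (ipC _ _ (spf (psi k)) (spf (phi k))); ring.
  set l := ipD s _ _ in c4.
  by rewrite (_ : 0 = K i i * (l - (l + l) + l)); [exact: c4|ring].
have XY : (fun k => ipP (X k) Y) @ \oo --> (0 : R).
  apply/norm_cvg0P.
  apply: (squeeze_cvgr (f := fun=> 0 : R)
    (h := fun k => Num.sqrt (ipP (X k) (X k)) * Num.sqrt (ipP Y Y))).
  - by apply: nearW => k; rewrite normr_ge0/= norm_ip.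
  - exact: cvg_cst.
  - rewrite -[X in _ --> X](mul0r (Num.sqrt (ipP Y Y))).
    apply: cvgM; last exact: cvg_cst.
    rewrite -[0 : R]sqrtr0.
    by apply: (@continuous_cvg _ _ _ _ _ _ Num.sqrt) => //; exact: sqrt_continuous.
have cY := @cvgL2_cst _ _ _ Pr setT Y.
have c1 := ip_cvg measurableT (fun k => sqint_sp_integral (phi k) i t0)
  (fun=> sY) sZ sY cZ cY.
have c2 := ip_cvg measurableT sJ (fun=> sY) sZ' sY cZ' cY.
rewrite -(cvg_lim (@Rhausdorff R) c1); apply: cvg_lim => //.
rewrite (_ : (fun k => _) = (fun k => ipP (X k) Y
    + ipP (sp_integral (beta i) (psi k) s) Y)).
  by rewrite -[ipP Z' Y]add0r; exact: cvgD.
apply/funext => k.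
by rewrite (sp_martingale (phi k) i s0 st mY sY) /X ipBl// subrK.
Qed.

End ito_integral.

(** * Integrals over time *)

Lemma ae_eq_Rintegral (d : measure_display) (T : measurableType d) (R : realType)
    (m : {measure set T -> \bar R}) (D : set T) (f g : T -> R) :
  measurable D -> measurable_fun D f -> measurable_fun D g ->
  {ae m, forall x, D x -> f x = g x} ->
  \int[m]_(x in D) f x = \int[m]_(x in D) g x.
Proof.
move=> mD mf mg fg; congr fine; apply: ae_eq_integral => //.
- exact/measurable_EFinP.
- exact/measurable_EFinP.
- by apply: filterS fg => x /[apply] ->.
Qed.

(** Tonelli on the positive and negative parts needs no integrability. This matters because the
    paths of the drift are integrable only almost surely. *)
Lemma measurable_fun_integral (d1 d2 : measure_display) (T1 : measurableType d1)
    (T2 : measurableType d2) (R : realType)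
    (m : {sigma_finite_measure set T2 -> \bar R}) (g : T1 * T2 -> \bar R) :
  measurable_fun setT g -> measurable_fun setT (fun x => \int[m]_y g (x, y))%E.
Proof.
move=> mg.
rewrite (_ : (fun x => _) = (fun x => \int[m]_y g^\+ (x, y) -
    \int[m]_y g^\- (x, y))%E); last first.
  apply/funext => x; rewrite [LHS]integralE.
  under eq_integral do rewrite funepos_comp/=.
  by under [X in (_ - X = _)%E]eq_integral do rewrite funeneg_comp/=.
apply: emeasurable_funB.
- exact: (measurable_fun_fubini_tonelli_F (m2 := m) _ (measurable_funepos mg)
    (funepos_ge0 g)).
- exact: (measurable_fun_fubini_tonelli_F (m2 := m) _ (measurable_funeneg mg)
    (funeneg_ge0 g)).
Qed.

Section integral_product.
Context {R : realType}.
Local Notation mu := (@lebesgue_measure R).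
Local Notation RT := (measurableTypeR R).
Variables (t : R) (f g : RT -> R).
Hypothesis t0 : 0 <= t.
Local Notation E := (times t%:E).
Hypothesis intf : mu.-integrable E (EFin \o f).
Hypothesis intg : mu.-integrable E (EFin \o g).

Lemma integrable_times (h : RT -> R) s : times t%:E s ->
  mu.-integrable E (EFin \o h) -> mu.-integrable (times s%:E) (EFin \o h).
Proof.
move=> sE; apply: integrableS; try exact: measurable_times.
exact: times_le.
Qed.

Let mE : measurable (E : set RT) := measurable_times t%:E.
(** The strips of the Fubini lemmas restrict the first coordinate only, so g is extended by zero.
    The kernel [h] below is f(r) g(s) on the triangle r <= s. *)
Let gE : RT -> R := g \_ E.
Let h (z : RT * RT) : R := f z.1 * gE z.2 * (z.1 <= z.2)%R%:R.

Let intgE : mu.-integrable setT (EFin \o gE).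
Proof. by rewrite /gE -restrict_EFin; apply/(integrable_mkcond _ mE). Qed.

Let mh : measurable_fun (E `*` setT) h.
Proof.
apply: measurable_funM; first apply: measurable_funM.
- have mf : measurable_fun E f by apply/measurable_EFinP; exact: measurable_int intf.
  apply: (measurable_comp (F := E)) => //; first by move=> _ [z [/= ? _] <-].
  exact: measurable_funTS.
- have mgE : measurable_fun setT gE.
    by apply/measurable_EFinP; exact: measurable_int intgE.
  by apply: measurable_funTS; exact: measurableT_comp.
- apply: measurable_funTS.
  have -> : (fun z : RT * RT => (z.1 <= z.2)%R%:R) =
      (fun z => if z.1 <= z.2 then 1 else 0) :> (RT * RT -> R).
    by apply/funext => z; case: ifP.
  apply: measurable_fun_ifT => //.
  exact: measurable_fun_ler.
Qed.

Let inth : (mu \x mu)%E.-integrable (E `*` setT) (EFin \o h).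
Proof.
apply/integrableP; split; first exact/measurable_EFinP.
have mabsh : measurable_fun (E `*` setT) (fun z => `|(h z)%:E|%E).
  by apply: measurableT_comp => //; exact/measurable_EFinP.
rewrite tonelli_strip1//.
(* Dropping the indicator of the triangle leaves a product of two finite integrals. *)
apply: (@le_lt_trans _ _ (\int[mu]_(x in E) (`|(f x)%:E| * \int[mu]_y `|(gE y)%:E|))%E).
  have ig0 : (0 <= \int[mu]_y `|(gE y)%:E|)%E by exact: integral_ge0.
  apply: ge0_le_integral => //.
  - by move=> x _; exact: integral_ge0.
  - exact: (measurable_tonelli_strip1 mu mE mabsh).
  - apply: emeasurable_funM => //; apply: measurableT_comp => //.
    exact: measurable_int intf.
  - move=> x xE; rewrite -ge0_integralZl//.
    + apply: ge0_le_integral => //.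
      * apply: measurableT_comp => //; apply/measurable_EFinP.
        have : measurable_fun setT (fun y : RT => h (x, y)).
          apply: (measurable_comp (F := E `*` setT)) mh _ => //.
            exact: measurableX.
          by move=> _ [y _ <-].
        by [].
      * apply: emeasurable_funM => //; apply: measurableT_comp => //.
        exact: measurable_int intgE.
      * move=> y _; rewrite /h/= -EFinM lee_fin !normrM ler_piMr ?mulr_ge0//.
        by rewrite normr_nat lern1; case: (_ <= _).
    + by apply: measurableT_comp => //; exact: measurable_int intgE.
rewrite ge0_integralZr//.
- have /integrableP[_ fy] := intf; have /integrableP[_ gy] := intgE.
  rewrite lte_mul_pinfty// ?integral_ge0//.
  by rewrite ge0_fin_numE// integral_ge0.
- by apply: measurableT_comp => //; exact: measurable_int intf.
- exact: integral_ge0.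
Qed.

(** Integration by parts for absolutely continuous functions. Integrating [h] over r first gives the
    second summand; integrating over s first gives f(r) times the integral of g over [r, t], which
    is the left-hand side minus the first summand. *)
Lemma integral_product :
  (\int[mu]_(s in E) f s) * (\int[mu]_(s in E) g s) =
  \int[mu]_(s in E) (f s * \int[mu]_(r in times s%:E) g r) +
  \int[mu]_(s in E) (g s * \int[mu]_(r in times s%:E) f r).
Proof.
have H1 := fubini_strip1 mE inth; have H2 := fubini_strip2 mE inth.
have E2 : \int[(mu \x mu)%E]_(z in E `*` setT) h z =
    \int[mu]_(s in E) (g s * \int[mu]_(r in times s%:E) f r).
  rewrite H2 [RHS]Rintegral_mkcond; apply: eq_Rintegral => s _.
  rewrite patchE; case: ifPn => [/set_mem sE|/negP sE]; last first.
    rewrite (@eq_Rintegral _ _ _ _ _ (fun=> 0)) => [|r _].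
      by rewrite Rintegral_cst// mul0r.
    by rewrite /h /gE/= patchE ifF ?mulr0 ?mul0r//; apply/negbTE/negP.
  rewrite -RintegralZl; [|exact: measurable_times|exact: integrable_times sE intf].
  rewrite [RHS]Rintegral_mkcond [LHS]Rintegral_mkcond; apply: eq_Rintegral => r _.
  rewrite !patchE /h /gE /= patchE (mem_set sE).
  have [r0|r0] := leP 0 r; last first.
    by rewrite !ifF//; apply/negbTE/negP => /set_mem[]; rewrite leNgt r0.
  have [rs|rs] := leP r s; last first.
    rewrite mulr0 [RHS]ifF; first by case: ifP.
    by apply/negbTE/negP => /set_mem[_]; rewrite lee_fin leNgt rs.
  case: sE => _ sE.
  rewrite !ifT; first by rewrite mulr1 mulrC.
  - by rewrite inE; split => //; rewrite lee_fin.
  - by rewrite inE; split => //; exact: le_trans sE.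
have inner r : E r -> \int[mu]_s h (r, s) =
    f r * (\int[mu]_(s in E) g s - \int[mu]_(s in times r%:E) g s).
  move=> rE; have [r0 rt] := rE; rewrite lee_fin in rt.
  have itg : mu.-integrable `[0, t] (EFin \o g) by rewrite -timesE.
  rewrite !timesE (Rintegral_itvB itg)//.
  have itg' : mu.-integrable `]r, t] (EFin \o g).
    by apply: integrableS itg => //; apply: subset_itvr; rewrite bnd_simp.
  rewrite Rintegral_itv_obnd_cbnd// -RintegralZl//; last first.
    by apply: integrableS itg => //; apply: subset_itvr; rewrite bnd_simp.
  rewrite [RHS]Rintegral_mkcond; apply: eq_Rintegral => s _.
  rewrite /h/= /gE !patchE timesE !mem_setE !in_itv/=.
  have [rs|rs] := leP r s; last by rewrite mulr0.
  by rewrite (le_trans r0 rs)/= mulr1; case: ifP => _; rewrite ?mulr0.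
have intfg : mu.-integrable E (EFin \o (fun r => f r * \int[mu]_(s in E) g s)).
  by apply: eq_integrable (integrableZr mE (\int[mu]_(s in E) g s) intf).
have i1 := integrable_strip1 mE inth.
have i2 : mu.-integrable E (EFin \o (fun r => f r * \int[mu]_(s in times r%:E) g s)).
  apply: eq_integrable (integrableB mE intfg i1) => // r /set_mem rE.
  by rewrite /= -EFinB inner//; congr EFin; ring.
rewrite -E2 H1 -(RintegralZr _ mE intf) -(RintegralD mE i2 i1).
by apply: eq_Rintegral => r /set_mem rE; rewrite inner//; ring.
Qed.

End integral_product.

Section time_integral.
Context {R : realType} {d : measure_display} {Omega : measurableType d}.
Variable Pr : probability Omega R.

Local Notation mu := (@lebesgue_measure R).
Local Notation RT := (measurableTypeR R).
Local Notation muP := (mu \x Pr)%E.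
Local Notation ipP := (ip Pr setT).
Local Notation sqP := (sqint Pr setT).

Definition time_integral (a : RT * Omega -> R) (z : RT * Omega) : R :=
  \int[mu]_(r in times z.1%:E) a (r, z.2).

Variable t : R.
Hypothesis t0 : 0 <= t.

Local Notation S := (strip t%:E).
Local Notation ipD := (ip muP S).
Local Notation sqD := (sqint muP S).

Let mS : measurable (S : set (RT * Omega)) := measurable_time_strip t%:E.
Let mE : measurable (times t%:E : set RT) := measurable_times t%:E.
Let tE : times t%:E t.
Proof. by split. Qed.

Lemma measurable_strip_pair2 (f : RT * Omega -> R) s : times t%:E s ->
  measurable_fun S f -> measurable_fun setT (fun w => f (s, w)).
Proof.
move=> sE mf; apply: (measurable_comp (F := S)) mf _ => //.
by move=> _ [w _ <-].
Qed.

Lemma measurable_strip_pair1 (f : RT * Omega -> R) w :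
  measurable_fun S f -> measurable_fun (times t%:E : set RT) (fun s => f (s, w)).
Proof.
move=> mf; apply: (measurable_comp (F := S)) mf _ => //.
  by move=> _ [s sE <-].
exact: measurable_funTS.
Qed.

(** The moving upper limit is absorbed into the integrand: a is restricted to the set [G] of triples
    (s, w, r) and integrated over all r. *)
Lemma measurable_time_integral (a : RT * Omega -> R) : measurable_fun S a ->
  measurable_fun S (time_integral a).
Proof.
move=> ma.
(* Here s runs over all reals; r <= t keeps (r, w) inside [S], where a is known to be measurable. *)
pose G : set ((RT * Omega) * RT) := [set y | [/\ 0 <= y.2, y.2 <= y.1.1 & y.2 <= t]].
have mG : measurable G.
  have m1 (f g : (RT * Omega) * RT -> R) : measurable_fun setT f ->
      measurable_fun setT g -> measurable [set y | f y <= g y].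
    move=> mf mg; have := measurable_fun_ler mf mg.
    move=> /(_ measurableT [set true]) => /(_ I); rewrite setTI.
    by congr measurable; apply/seteqP; split => y.
  rewrite (_ : G = [set y | 0 <= y.2] `&` [set y | y.2 <= y.1.1] `&` [set y | y.2 <= t]).
    apply: measurableI; [apply: measurableI|]; apply: m1 => //.
    exact: measurableT_comp.
  by apply/seteqP; split => y [] // [].
pose g : (RT * Omega) * RT -> \bar R := (fun y => (a (y.2, y.1.2))%:E) \_ G.
have mg : measurable_fun setT g.
  apply/(measurable_restrictT _ mG); apply/measurable_EFinP.
  apply: (measurable_comp (F := S)) ma _ => //.
    by move=> _ [y [y0 _ yt] <-]; split => //; split.
  apply: measurable_funTS; apply: measurable_fun_pair => //.
  exact: measurableT_comp.
have mI : measurable_fun S (fun x => \int[mu]_y g (x, y))%E.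
  by apply: measurable_funTS; exact: measurable_fun_integral.
have : measurable_fun S (fine \o (fun x => \int[mu]_y g (x, y))%E).
  exact: measurableT_comp mI.
apply: eq_measurable_fun => -[s w] /set_mem[[/= s0 st] _].
rewrite lee_fin in st.
rewrite /time_integral Rintegral_mkcond /Rintegral; congr fine.
apply: eq_integral => r _; rewrite /g !patchE.
suff -> : ((s, w, r) \in G) = (r \in times s%:E) by case: ifP.
apply/idP/idP => /set_mem.
  by move=> -[/= r0 rs rt]; rewrite inE; split => //; rewrite lee_fin.
move=> -[/= r0 rs]; rewrite lee_fin in rs.
by rewrite inE; split => //=; exact: le_trans st.
Qed.

(* The factor t + 1, rather than t, keeps the right-hand side infinite at t = 0
   when the path of a is not square-integrable. *)
Lemma time_integral_le (a : RT * Omega -> R) s w : measurable_fun S a ->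
  times t%:E s ->
  ((time_integral a (s, w) ^+ 2)%:E <=
   (t + 1)%:E * \int[mu]_(r in times t%:E) ((a (r, w)) ^+ 2)%:E)%E.
Proof.
move=> ma sE; have [s0 st] := sE; rewrite lee_fin in st.
have t1 : 0 < t + 1 by rewrite ltr_wpDl.
have i0 : (0 <= \int[mu]_(r in times t%:E) ((a (r, w)) ^+ 2)%:E)%E.
  by apply: integral_ge0 => r _; rewrite lee_fin sqr_ge0.
have := leey (\int[mu]_(r in times t%:E) ((a (r, w)) ^+ 2)%:E)%E.
rewrite le_eqVlt => /predU1P[->|fin].
  by rewrite gt0_muley ?lte_fin// leey.
have sa : sqint mu (times t%:E) (fun r => a (r, w)).
  by split => //; exact: measurable_strip_pair1.
have mEs : measurable (times s%:E : set RT) := measurable_times s%:E.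
have sas : sqint mu (times s%:E) (fun r => a (r, w)).
  split; first by apply: measurable_funS (sqint_measurable sa) => //; exact: times_le.
  apply: le_lt_trans fin; apply: ge0_subset_integral => //.
  - by apply/measurable_EFinP; apply: measurable_funX; exact: measurable_strip_pair1.
  - by move=> r _; rewrite lee_fin sqr_ge0.
  - exact: times_le.
have s1 : sqint mu (times s%:E) (fun=> 1).
  split => //; rewrite integral_cst// expr1n mul1e.
  by rewrite [ltLHS](_ : _ = s%:E) ?ltry//; exact: mu_times.
(* Cauchy-Schwarz against the constant 1, whose squared norm on [0, s] is s. *)
have -> : time_integral a (s, w) = ip mu (times s%:E) (fun r => a (r, w)) (fun=> 1).
  by apply: eq_Rintegral => r _; rewrite mulr1.
apply: (@le_trans _ _ (ip mu (times s%:E) (fun r => a (r, w)) (fun r => a (r, w)) *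
    ip mu (times s%:E) (fun=> 1) (fun=> 1))%:E).
  by rewrite lee_fin cauchy_schwarz.
have -> : ip mu (times s%:E) (fun=> 1) (fun=> 1) = s.
  rewrite /ip Rintegral_cst// mulr1 mul1r (_ : s = fine s%:E)//; congr fine.
  exact: mu_times.
rewrite mulrC EFinM lee_pmul//.
- by rewrite lee_fin ip_ge0.
- by rewrite lee_fin (le_trans st)// lerDl.
- rewrite EFin_ip_sqr//; apply: ge0_subset_integral => //.
  + by apply/measurable_EFinP; apply: measurable_funX; exact: measurable_strip_pair1.
  + by move=> r _; rewrite lee_fin sqr_ge0.
  + exact: times_le.
Qed.

Section square_integrable_drift.
Variable a : RT * Omega -> R.
Hypothesis sa : sqD a.

Let ma : measurable_fun S a := sqint_measurable sa.
Let ma2 : measurable_fun S (fun z => ((a z) ^+ 2)%:E).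
Proof. by apply/measurable_EFinP; exact: measurable_funX. Qed.

Let I (w : Omega) : \bar R := (\int[mu]_(r in times t%:E) ((a (r, w)) ^+ 2)%:E)%E.

Let I0 w : (0 <= I w)%E.
Proof. by apply: integral_ge0 => r _; rewrite lee_fin sqr_ge0. Qed.

Let mI : measurable_fun setT I.
Proof.
apply: (measurable_tonelli_strip2 mu mE ma2).
by move=> z _; rewrite lee_fin sqr_ge0.
Qed.

Let intI : (\int[Pr]_w I w < +oo)%E.
Proof.
have [_] := sa; rewrite tonelli_strip2//.
by move=> z _; rewrite lee_fin sqr_ge0.
Qed.

Let t1 : 0 <= t + 1. Proof. by rewrite addr_ge0. Qed.

Lemma sqint_time_integral_at s : times t%:E s ->
  sqP (fun w => time_integral a (s, w)).
Proof.
move=> sE.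
have mA : measurable_fun setT (fun w => time_integral a (s, w)).
  exact: (measurable_strip_pair2 sE (measurable_time_integral ma)).
split => //.
apply: (@le_lt_trans _ _ (\int[Pr]_w ((t + 1)%:E * I w))%E).
  apply: ge0_le_integral => //.
  - by move=> w _; rewrite lee_fin sqr_ge0.
  - by apply/measurable_EFinP; exact: measurable_funX.
  - by apply: emeasurable_funM.
  - by move=> w _; exact: time_integral_le.
rewrite ge0_integralZl// lte_mul_pinfty// lee_fin//.
Qed.

Lemma sqint_time_integral : sqD (time_integral a).
Proof.
have mA := measurable_time_integral ma; split => //.
have mA2 : measurable_fun S (fun z => ((time_integral a z) ^+ 2)%:E).
  by apply/measurable_EFinP; exact: measurable_funX.
apply: (@le_lt_trans _ _ (\int[muP]_(z in S) ((t + 1)%:E * I z.2))%E).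
  apply: ge0_le_integral => //.
  - by move=> z _; rewrite lee_fin sqr_ge0.
  - apply: emeasurable_funM => //; apply: measurable_funTS.
    exact: measurableT_comp.
  - by move=> [s w] [/= sE _]; exact: time_integral_le.
rewrite tonelli_strip1//.
- rewrite /= integral_cst// [X in (_ * X)%E](_ : _ = t%:E); last exact: mu_times.
  rewrite [X in (X * _)%E](_ : _ = (t + 1)%:E * \int[Pr]_w I w)%E; last first.
    by rewrite -ge0_integralZl.
  have fI : (\int[Pr]_w I w \is a fin_num)%E by rewrite ge0_fin_numE// integral_ge0.
  by rewrite -(fineK fI) -!EFinM ltry.
- apply: emeasurable_funM => //; apply: measurable_funTS.
  exact: measurableT_comp.
- by move=> z _; rewrite mule_ge0// lee_fin.
Qed.

Lemma ae_sqint_section : {ae Pr, forall w, sqint mu (times t%:E) (fun s => a (s, w))}.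
Proof.
have [_ /(ae_integrable_strip2 mE)] := (sqintP _ _ _).1 sa.
apply: filterS => w iw; apply/sqintP; split => //.
exact: measurable_strip_pair1.
Qed.

Lemma ae_integrable_section :
  {ae Pr, forall w, mu.-integrable (times t%:E) (EFin \o (fun s => a (s, w)))}.
Proof.
have s1 : sqint mu (times t%:E) (fun=> 1).
  split => //; rewrite integral_cst// expr1n mul1e.
  by rewrite [ltLHS](_ : _ = t%:E) ?ltry//; exact: mu_times.
apply: filterS ae_sqint_section => w sw.
have := integrable_sqintM mE sw s1.
by apply: eq_integrable => // s _ /=; rewrite mulr1.
Qed.

Lemma ae_sqint_section1 :
  {ae mu, forall s, times t%:E s -> sqP (fun w => a (s, w))}.
Proof.
have [_ /(ae_integrable_strip1 mE)] := (sqintP _ _ _).1 sa.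
apply: filterS => s iw sE; apply/sqintP; split; last exact: iw.
exact: measurable_strip_pair2.
Qed.

Lemma ip_time_integral (M : Omega -> R) : sqP M ->
  ipP (fun w => time_integral a (t, w)) M = ipD a (fun z => M z.2).
Proof.
move=> sM; have sM2 := sqint_snd t0 sM.
rewrite ip_strip2//.
have sA := sqint_time_integral_at tE.
apply: ae_eq_Rintegral => //.
- by apply: measurable_funM; [exact: sqint_measurable sA|exact: sqint_measurable sM].
- apply/measurable_EFinP.
  exact: measurable_int (integrable_strip2 mE (integrable_sqintM mS sa sM2)).
- apply: filterS ae_integrable_section => w iw _.
  by rewrite /= RintegralZr.
Qed.

End square_integrable_drift.

(** [integral_product] on almost every path, then expectation. *)
Lemma ip_time_integral_product (a b : RT * Omega -> R) : sqD a -> sqD b ->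
  ipP (fun w => time_integral a (t, w)) (fun w => time_integral b (t, w)) =
  ipD a (time_integral b) + ipD b (time_integral a).
Proof.
move=> sa sb.
have sA := sqint_time_integral sa; have sB := sqint_time_integral sb.
have i1 := integrable_strip2 mE (integrable_sqintM mS sa sB).
have i2 := integrable_strip2 mE (integrable_sqintM mS sb sA).
rewrite !ip_strip2// -(RintegralD measurableT i1 i2).
apply: ae_eq_Rintegral => //.
- apply: measurable_funM.
    exact: sqint_measurable (sqint_time_integral_at sa tE).
  exact: sqint_measurable (sqint_time_integral_at sb tE).
- apply: measurable_funD; apply/measurable_EFinP; [exact: measurable_int i1|
    exact: measurable_int i2].
- have aa := ae_integrable_section sa; have ab := ae_integrable_section sb.
  by apply: filterS2 aa ab => w iaw ibw _; exact: integral_product.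
Qed.

End time_integral.

(** * Second moments of solutions *)

Section product_rule.
Context {R : realType} {d : measure_display} {Omega : measurableType d}.
Variables (Pr : probability Omega R) (F : R -> set_system Omega).

Local Notation mu := (@lebesgue_measure R).
Local Notation RT := (measurableTypeR R).
Local Notation muP := (mu \x Pr)%E.
Local Notation ipP := (ip Pr setT).
Local Notation sqP := (sqint Pr setT).

Variable t : R.
Hypothesis t0 : 0 <= t.

Local Notation S := (strip t%:E).
Local Notation ipD := (ip muP S).
Local Notation sqD := (sqint muP S).

Let mS : measurable (S : set (RT * Omega)) := measurable_time_strip t%:E.
Let mE : measurable (times t%:E : set RT) := measurable_times t%:E.
Let tE : times t%:E t.
Proof. by split. Qed.

(** The martingale part of x. *)
Definition compensated (x a : RT * Omega -> R) (c : R) (z : RT * Omega) : R :=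
  x z - c - time_integral a z.

(* x is c plus the time integral of a plus a centered L^2-martingale on [0, t],
   the latter being tested against square-integrable variables only. *)
Definition driven (x a : RT * Omega -> R) (c : R) : Prop :=
  [/\ sqD x, sqD a, forall s, times t%:E s -> measurable_wrt (F s) (fun w => a (s, w)),
    sqP (fun w => x (t, w)) &
    (forall s Y, times t%:E s -> measurable_wrt (F s) Y -> sqP Y ->
       ipP (fun w => compensated x a c (t, w)) Y =
       ipP (fun w => compensated x a c (s, w)) Y) /\
    ipP (fun w => compensated x a c (t, w)) (fun=> 1) = 0].

Lemma sqD_cst c : sqD (fun=> c).
Proof. exact: (sqint_snd t0 (sqint_cst Pr c)). Qed.

Lemma sqint_compensated x a c : driven x a c -> sqD (compensated x a c).
Proof.
move=> [sx sa _ _ _]; apply: (sqintB mS); last exact: sqint_time_integral.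
by apply: (sqintB mS) => //; exact: sqD_cst.
Qed.

Lemma sqint_compensated_at x a c : driven x a c ->
  sqP (fun w => compensated x a c (t, w)).
Proof.
move=> [sx sa _ sxt _]; apply: (sqintB measurableT).
  by apply: (sqintB measurableT) => //; exact: sqint_cst.
exact: (sqint_time_integral_at t0 sa tE).
Qed.

(** Fubini brings the time integral outside, and the martingale property is tested against Y = a(s).
    Since a(s) is known to be in L^2 only for almost every s, the integrands in s are compared
    almost everywhere. *)
Lemma ip_drift_martingale a x b c : sqD a ->
  (forall s, times t%:E s -> measurable_wrt (F s) (fun w => a (s, w))) ->
  driven x b c ->
  ipP (fun w => time_integral a (t, w)) (fun w => compensated x b c (t, w)) =
  ipD a (compensated x b c).
Proof.
move=> sa ada dx; have sM := sqint_compensated_at dx.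
have sM2 := sqint_snd t0 sM; have sC := sqint_compensated dx.
rewrite (ip_time_integral t0 sa sM) (ip_strip1 sa sM2) (ip_strip1 sa sC).
apply: (ae_eq_Rintegral mE).
- apply/measurable_EFinP.
  exact: measurable_int (integrable_strip1 mE (integrable_sqintM mS sa sM2)).
- apply/measurable_EFinP.
  exact: measurable_int (integrable_strip1 mE (integrable_sqintM mS sa sC)).
- have := ae_sqint_section1 sa.
  apply: filterS; first exact: (ae_filter_ringOfSetsType mu).
  move=> s sas sE; have [_ _ _ _ [mart _]] := dx.
  by have := mart s _ sE (ada s sE) (sas sE); rewrite ipC [RHS]ipC.
Qed.

(** With x_i = c_i + A_i + m_i, the term E A1 m2 equals <a1, x2> - c2 E A1 - <a1, A2>, and
    symmetrically for E A2 m1. The constants times E A_i cancel against the products c_j A_i, and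
    <a1, A2> + <a2, A1> cancels against E A1 A2. *)
Lemma product_rule x1 a1 c1 x2 a2 c2 : driven x1 a1 c1 -> driven x2 a2 c2 ->
  ipP (fun w => x1 (t, w)) (fun w => x2 (t, w)) =
  c1 * c2 + ipD x1 a2 + ipD a1 x2 +
  ipP (fun w => compensated x1 a1 c1 (t, w))
      (fun w => compensated x2 a2 c2 (t, w)).
Proof.
move=> d1 d2; have [sx1 sa1 ad1 sx1t [_ mean1]] := d1.
have [sx2 sa2 ad2 sx2t [_ mean2]] := d2.
set m1 := (fun w => compensated x1 a1 c1 (t, w)) in mean1 *.
set m2 := (fun w => compensated x2 a2 c2 (t, w)) in mean2 *.
pose A1 w := time_integral a1 (t, w); pose A2 w := time_integral a2 (t, w).
have sm1 : sqP m1 by exact: sqint_compensated_at.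
have sm2 : sqP m2 by exact: sqint_compensated_at.
have sA1 : sqP A1 by exact: (sqint_time_integral_at t0 sa1 tE).
have sA2 : sqP A2 by exact: (sqint_time_integral_at t0 sa2 tE).
have s1 : sqP (fun=> 1) by exact: sqint_cst.
have E1 : ipP A1 m2 = ipD a1 x2 - c2 * ipP A1 (fun=> 1) - ipD a1 (time_integral a2).
  rewrite (ip_drift_martingale sa1 ad1 d2) /compensated.
  have sc := sqD_cst c2; have sT := sqint_time_integral t0 sa2.
  rewrite (ipBr mS (sqintB mS sx2 sc) sT sa1) (ipBr mS sx2 sc sa1).
  rewrite (ip_time_integral t0 sa1 s1) -(ipZr mS c2 sa1 (sqD_cst 1)).
  by congr (_ - _ - _); apply: eq_ip => // z _; rewrite mulr1.
have E2 : ipP A2 m1 = ipD a2 x1 - c1 * ipP A2 (fun=> 1) - ipD a2 (time_integral a1).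
  rewrite (ip_drift_martingale sa2 ad2 d1) /compensated.
  have sc := sqD_cst c1; have sT := sqint_time_integral t0 sa1.
  rewrite (ipBr mS (sqintB mS sx1 sc) sT sa2) (ipBr mS sx1 sc sa2).
  rewrite (ip_time_integral t0 sa2 s1) -(ipZr mS c1 sa2 (sqD_cst 1)).
  by congr (_ - _ - _); apply: eq_ip => // z _; rewrite mulr1.
have E3 : ipP A1 A2 = ipD a1 (time_integral a2) + ipD a2 (time_integral a1).
  exact: ip_time_integral_product.
transitivity (ipP (fun w => c1 * 1 + (A1 w + m1 w)) (fun w => c2 * 1 + (A2 w + m2 w))).
  by apply: eq_ip => w _; rewrite /A1 /m1 /A2 /m2 /compensated; ring.
have sAm1 := sqintD measurableT sA1 sm1; have sAm2 := sqintD measurableT sA2 sm2.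
have sc1 := sqintZ measurableT c1 s1; have sc2 := sqintZ measurableT c2 s1.
rewrite (ipDl measurableT sc1 sAm1 (sqintD measurableT sc2 sAm2)).
rewrite (ipDr measurableT sc2 sAm2 sc1) (ipDr measurableT sc2 sAm2 sAm1).
rewrite (ipDl measurableT sA1 sm1 sc2) (ipDl measurableT sA1 sm1 sAm2).
rewrite (ipDr measurableT sA2 sm2 sc1) (ipDr measurableT sA2 sm2 sA1).
rewrite (ipDr measurableT sA2 sm2 sm1).
rewrite (ipZl measurableT c1 s1 sc2) (ipZl measurableT c1 s1 sA2).
rewrite (ipZl measurableT c1 s1 sm2) (ipZr measurableT c2 s1 s1).
rewrite (ipZr measurableT c2 sA1 s1) (ipZr measurableT c2 sm1 s1).
have -> : ipP (fun=> 1) (fun=> 1) = 1.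
  rewrite /ip Rintegral_cst// [X in fine X](_ : _ = 1%E) ?mulr1//.
  exact: probability_setT.
rewrite (ipC _ _ (fun=> 1) A2) (ipC _ _ (fun=> 1) m2) mean1 mean2.
rewrite (ipC _ _ m1 A2) E1 E2 E3 (ipC _ _ a2 x1).
move: (ipD a1 x2) (ipD x1 a2) (ipP A1 _) (ipP A2 _) (ipP m1 m2).
move: (ipD a1 _) (ipD a2 _) => *; ring.
Qed.

End product_rule.

(** * Vector-valued square-integrable functions *)

Section vector_valued.
Context {d : measure_display} {T : measurableType d} {R : realType}.
Variables (m : {measure set T -> \bar R}) (D : set T).
Hypothesis mD : measurable D.

Definition sqintv n (f : T -> 'cV[R]_n) := forall k, sqint m D (fun z => f z k 0).

Lemma dotvE n (v w : 'cV[R]_n) : dotv v w = \sum_k v k 0 * w k 0.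
Proof. by rewrite /dotv mxE; apply: eq_bigr => k _; rewrite mxE. Qed.

Lemma sqnormE n (v : 'cV[R]_n) : sqnorm v = \sum_k v k 0 ^+ 2.
Proof. by rewrite /sqnorm dotvE; apply: eq_bigr => k _; rewrite expr2. Qed.

Lemma sqnorm_ge0 n (v : 'cV[R]_n) : 0 <= sqnorm v.
Proof. by rewrite sqnormE sumr_ge0// => k _; rewrite sqr_ge0. Qed.

Lemma sqintvM p n (M : 'M[R]_(p, n)) (f : T -> 'cV[R]_n) : sqintv f ->
  sqintv (fun z => M *m f z).
Proof.
move=> sf k.
apply: (eq_sqint mD (f := fun z => \sum_j M k j * f z j 0)).
  by move=> z _; rewrite mxE.
by apply: (sqint_sum mD) => j; exact: (sqintZ mD).
Qed.

Lemma sqintvD n (f g : T -> 'cV[R]_n) : sqintv f -> sqintv g ->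
  sqintv (fun z => f z + g z).
Proof.
move=> sf sg k; apply: eq_sqint (sqintD mD (sf k) (sg k)) => // z _.
by rewrite mxE.
Qed.

Lemma integrable_Rsum (I : Type) (s : seq I) (h : I -> T -> R) :
  (forall i, m.-integrable D (EFin \o h i)) ->
  m.-integrable D (EFin \o (fun z => \sum_(i <- s) h i z)).
Proof.
move=> ih.
have : m.-integrable D (fun z => \sum_(i <- s) (h i z)%:E)%E.
  by apply: (integrable_sum mD) => i *; exact: ih.
by apply: eq_integrable => // z _ /=; rewrite sumEFin.
Qed.

Lemma Rintegral_sum (I : Type) (s : seq I) (h : I -> T -> R) :
  (forall i, m.-integrable D (EFin \o h i)) ->
  \int[m]_(z in D) (\sum_(i <- s) h i z) = \sum_(i <- s) \int[m]_(z in D) h i z.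
Proof.
move=> ih; elim: s => [|i s IH].
  rewrite big_nil (@eq_Rintegral _ _ _ _ _ (fun=> 0)) => [|z _]; last by rewrite big_nil.
  by rewrite Rintegral_cst// mul0r.
rewrite big_cons -IH -(RintegralD mD (ih i) (integrable_Rsum s ih)).
by apply: eq_Rintegral => z _; rewrite big_cons.
Qed.

Lemma integrable_dotv n (f g : T -> 'cV[R]_n) : sqintv f -> sqintv g ->
  m.-integrable D (EFin \o (fun z => dotv (f z) (g z))).
Proof.
move=> sf sg.
have : m.-integrable D (EFin \o (fun z => \sum_k f z k 0 * g z k 0)).
  by apply: integrable_Rsum => k; exact: (integrable_sqintM mD).
by apply: eq_integrable => // z _ /=; rewrite dotvE.
Qed.

Lemma Rintegral_dotv n (X : 'M[R]_n) (f g : T -> 'cV[R]_n) :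
  sqintv f -> sqintv g ->
  \int[m]_(z in D) dotv (f z) (X *m g z) =
  \sum_k \sum_l X k l * ip m D (fun z => f z k 0) (fun z => g z l 0).
Proof.
move=> sf sg.
transitivity (\sum_k ip m D (fun z => f z k 0) (fun z => (X *m g z) k 0)).
  rewrite -Rintegral_sum.
    by apply: eq_Rintegral => z _; rewrite dotvE.
  by move=> k; apply: (integrable_sqintM mD) => //; exact: sqintvM.
apply: eq_bigr => k _.
transitivity (ip m D (fun z => f z k 0) (fun z => \sum_l X k l * g z l 0)).
  by apply: eq_ip => // z _; rewrite mxE.
rewrite (ip_sumr mD)//; last by move=> l; exact: (sqintZ mD).
by apply: eq_bigr => l _; rewrite (ipZr mD).
Qed.

End vector_valued.

(** * The mean Ito formula for quadratic forms of the state *)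

Section energy_identity.
Context {R : realType} {d : measure_display} {Omega : measurableType d}.
Variables (Pr : probability Omega R) (F : R -> set_system Omega).
Hypothesis HF : is_filtration Pr F.
Variables (q : nat) (K : 'M[R]_q) (W : R -> Omega -> 'cV[R]_q).
Hypothesis HW : is_wiener Pr F K W.

Local Notation mu := (@lebesgue_measure R).
Local Notation RT := (measurableTypeR R).
Local Notation muP := (mu \x Pr)%E.
Local Notation ipP := (ip Pr setT).
Local Notation sqP := (sqint Pr setT).
Local Notation ipD t := (ip muP (strip t%:E)).

Lemma inL2_sqintv n T (v : R -> Omega -> 'cV[R]_n) : inL2 Pr F T v ->
  sqintv muP (strip T) (fun z => v z.1 z.2).
Proof.
move=> [_ mv vfin] k.
have mv' j : measurable_fun (strip T) (fun z : RT * Omega => v z.1 z.2 j 0) := mv j.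
have msq : measurable_fun (strip T) (fun z : RT * Omega => (sqnorm (v z.1 z.2))%:E).
  apply/measurable_EFinP.
  have -> : (fun z : RT * Omega => sqnorm (v z.1 z.2)) =
      (fun z => \sum_j v z.1 z.2 j 0 ^+ 2) by apply/funext => z; rewrite sqnormE.
  by apply: measurable_sum => j; exact: measurable_funX.
split => //; apply: le_lt_trans vfin.
rewrite /L2norm2 -(tonelli_strip2 mu Pr (measurable_times T) msq); last first.
  by move=> z _; rewrite lee_fin sqnorm_ge0.
apply: ge0_le_integral => //.
- exact: measurable_time_strip.
- by move=> z _; rewrite lee_fin sqr_ge0.
- by apply/measurable_EFinP; exact: measurable_funX.
- move=> z _; rewrite lee_fin sqnormE (bigD1 k)//= lerDl sumr_ge0// => j _.
  exact: sqr_ge0.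
Qed.

Lemma sqintvS n (D E : set (RT * Omega)) (f : RT * Omega -> 'cV[R]_n) :
  measurable D -> measurable E -> D `<=` E -> sqintv muP E f -> sqintv muP D f.
Proof.
move=> mD mE DE sf k; have [mf f2] := sf k; split.
  exact: measurable_funS mf.
apply: le_lt_trans f2; apply: ge0_subset_integral => //.
  by apply/measurable_EFinP; exact: measurable_funX.
by move=> z _; rewrite lee_fin sqr_ge0.
Qed.

Variables (n : nat) (A : 'M[R]_n) (N : 'I_q -> 'M[R]_n).
Variables (b : R -> Omega -> 'cV[R]_n) (T : \bar R) (x0 : 'cV[R]_n).
Variable x : R -> Omega -> 'cV[R]_n.
Hypothesis sol : is_solution Pr F W A N b T x0 x.
Hypothesis adb : adapted F T b.
(** Local in time, also for T = +oo: under feedback b = -BB'Q x, and a solution x is by definition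
    square-integrable on finite intervals. *)
Hypothesis sqb : forall t, times T t ->
  sqintv muP (strip t%:E) (fun z => b z.1 z.2).

Let xv (z : RT * Omega) : 'cV[R]_n := x z.1 z.2.
Let av (z : RT * Omega) : 'cV[R]_n := A *m x z.1 z.2 + b z.1 z.2.
Let C k : RT * Omega -> R :=
  compensated (fun z => xv z k 0) (fun z => av z k 0) (x0 k 0).

Let mS (t : R) := measurable_time_strip (Omega := Omega) t%:E.

Lemma sqint_state t : times T t -> sqintv muP (strip t%:E) xv.
Proof. by move=> tT; have [inx _ _ _] := sol; exact: inL2_sqintv (inx t tT). Qed.

Lemma sqint_drift t : times T t -> sqintv muP (strip t%:E) av.
Proof.
move=> tT; apply: (sqintvD (mS t)); last exact: sqb.
by apply: (sqintvM (mS t)); exact: sqint_state.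
Qed.

Let adx t k : times T t -> measurable_wrt (F t) (fun w => x t w k 0).
Proof. by move=> tT; have [_ [adx _] _ _] := sol; exact: adx. Qed.

Lemma adapted_drift t k : times T t -> measurable_wrt (F t) (fun w => av (t, w) k 0).
Proof.
move=> tT; have [t0 _] := tT.
have sF := filtration_sigma_algebra HF t0.
have -> : (fun w => av (t, w) k 0) =
    (fun w => (\sum_j A k j * x t w j 0) + b t w k 0).
  by apply/funext => w; rewrite /av !mxE.
apply: measurable_wrtD => //; last exact: adb.
apply: measurable_wrt_sum => // j; apply: measurable_wrtM => //.
  exact: measurable_wrt_cst.
exact: adx.
Qed.

(** At a fixed time the martingale part equals a sum of Ito integrals almost surely, hence is in
    L^2. Adding the constant and the time integral puts x(t) itself in L^2, for every t and not just
    almost every t. *)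
Lemma compensated_ito t : times T t -> exists Z : 'I_q -> Omega -> 'cV[R]_n,
  (forall i k, is_ito_integral Pr F (fun s w => W s w i 0)
     (fun s w => (N i *m x s w) k 0) t (fun w => Z i w k 0)) /\
  forall k, [/\ sqP (fun w => x t w k 0), sqP (fun w => C k (t, w)),
    forall i, sqP (fun w => Z i w k 0) &
    {ae Pr, forall w, C k (t, w) = \sum_i Z i w k 0}].
Proof.
move=> tT; have [t0 _] := tT; have [_ _ _ /(_ t tT)[Z [itoZ eqZ]]] := sol.
exists Z; split => // k.
have sZ i : sqP (fun w => Z i w k 0).
  apply: (sqint_ito HF HW t0) (itoZ i k).
  exact: sqint_measurable (sqintvM (mS t) (N i) (sqint_state tT) k).
have tE : times t%:E t by split.
have sA := sqint_time_integral_at t0 (sqint_drift tT k) tE.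
have ae : {ae Pr, forall w, \sum_i Z i w k 0 = C k (t, w)}.
  apply: filterS eqZ => w eqw.
  rewrite /C /compensated /xv/= eqw !mxE summxE.
  by rewrite /time_integral/= /av/=; ring.
have sx : measurable_fun setT (fun w => x t w k 0).
  exact: filtration_measurable HF _ _ t0 (adx k tT).
have sC : sqP (fun w => C k (t, w)).
  apply: ae_eq_sqint (sqint_sum measurableT _ sZ) ae.
  apply: measurable_funB; last exact: sqint_measurable sA.
  exact: measurable_funB.
split => //; last by apply: filterS ae => w ->.
have := sqintD measurableT (sqintD measurableT sC (sqint_cst Pr (x0 k 0))) sA.
by apply: eq_sqint => // w _; rewrite /C /compensated /xv/=; ring.
Qed.

Lemma sqint_state_at t : times T t -> sqintv Pr setT (x t).
Proof. by move=> tT k; have [Z [_ /(_ k)[]]] := compensated_ito tT. Qed.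

Lemma ip_compensated t k (Y : Omega -> R) (Z : 'I_q -> Omega -> 'cV[R]_n) :
  sqP (fun w => C k (t, w)) -> (forall i, sqP (fun w => Z i w k 0)) ->
  {ae Pr, forall w, C k (t, w) = \sum_i Z i w k 0} -> sqP Y ->
  ipP (fun w => C k (t, w)) Y = \sum_i ipP (fun w => Z i w k 0) Y.
Proof.
move=> sC sZ ae sY; rewrite -(ip_suml measurableT _ sZ sY).
by apply: ae_eq_ip => //; exact: (sqint_sum measurableT).
Qed.

Let mNx t i k : times T t -> measurable_fun (strip t%:E)
  (uncurry_process (fun s w => (N i *m x s w) k 0)).
Proof.
by move=> tT; exact: sqint_measurable (sqintvM (mS t) (N i) (sqint_state tT) k).
Qed.

(** The integral equations at s and at t supply separate Ito integrals; [ito_martingale] relates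
    them for each component of W. *)
Lemma state_driven t k : times T t ->
  driven Pr F t (fun z => xv z k 0) (fun z => av z k 0) (x0 k 0).
Proof.
move=> tT; have [t0 _] := tT.
have [Z [itoZ /(_ k)[sx sC sZ ae]]] := compensated_ito tT.
split; [exact: (sqint_state tT k)|exact: (sqint_drift tT k)| |exact: sx|].
- by move=> s st; apply: adapted_drift; exact: times_le st.
- split; last first.
    rewrite (ip_compensated sC sZ ae (sqint_cst Pr 1)) big1// => i _.
    exact: (ito_mean HF HW t0 (mNx i k tT) (itoZ i k)).
  move=> s Y st mY sY; have [s0 sle] := st; rewrite lee_fin in sle.
  have sT : times T s by exact: times_le st.
  have [Z' [itoZ' /(_ k)[_ sC' sZ' ae']]] := compensated_ito sT.
  rewrite (ip_compensated sC sZ ae sY) (ip_compensated sC' sZ' ae' sY).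
  apply: eq_bigr => i _.
  exact: (ito_martingale HF HW s0 sle (mNx i k tT) (itoZ i k) (itoZ' i k)).
Qed.

Lemma second_moment t k l : times T t ->
  ipP (fun w => x t w k 0) (fun w => x t w l 0) =
  x0 k 0 * x0 l 0 + ipD t (fun z => xv z k 0) (fun z => av z l 0)
  + ipD t (fun z => av z k 0) (fun z => xv z l 0)
  + \sum_i \sum_j K i j *
      ipD t (fun z => (N i *m xv z) k 0) (fun z => (N j *m xv z) l 0).
Proof.
move=> tT; have [t0 _] := tT.
rewrite (product_rule t0 (state_driven k tT) (state_driven l tT)); congr (_ + _).
have [Z [itoZ H]] := compensated_ito tT.
have [_ sCk sZk aek] := H k; have [_ sCl sZl ael] := H l.
rewrite (ip_compensated sCk sZk aek sCl); apply: eq_bigr => i _.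
rewrite ipC (ip_compensated sCl sZl ael (sZk i)); apply: eq_bigr => j _.
by rewrite ipC (ito_isometry HF HW t0 (mNx i k tT) (mNx j l tT) (itoZ i k) (itoZ j l)).
Qed.

Definition generator (X : 'M[R]_n) (v w : 'cV[R]_n) : R :=
  dotv v (X *m w) + dotv w (X *m v)
  + \sum_i \sum_j K i j * dotv (N i *m v) (X *m (N j *m v)).

Let sN t i : times T t -> sqintv muP (strip t%:E) (fun z => N i *m xv z).
Proof. by move=> tT; exact: (sqintvM (mS t) (N i) (sqint_state tT)). Qed.

Let sX t (X : 'M[R]_n) f : sqintv muP (strip t%:E) f ->
  sqintv muP (strip t%:E) (fun z => X *m f z) := @sqintvM _ _ _ _ _ (mS t) _ _ X f.

Lemma integrable_generator t (X : 'M[R]_n) : times T t ->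
  muP.-integrable (strip t%:E) (EFin \o (fun z => generator X (xv z) (av z))).
Proof.
move=> tT; have sx := sqint_state tT; have sa := sqint_drift tT.
have i1 := integrable_dotv (mS t) sx (sX X sa).
have i2 := integrable_dotv (mS t) sa (sX X sx).
have i3 i j := integrable_dotv (mS t) (sN i tT) (sX X (sN j tT)).
have i4 i j := integrableZl (mS t) (K i j) (i3 i j).
have i5 i := integrable_Rsum (mS t) (index_enum 'I_q) (i4 i).
have i6 := integrable_Rsum (mS t) (index_enum 'I_q) i5.
exact: (integrableD (mS t) (integrableD (mS t) i1 i2) i6).
Qed.

(** Both sides are expanded into entries, so that this is [second_moment] weighted by X k l and
    summed; the rest is reordering of finite sums. *)
Lemma energy_identity t (X : 'M[R]_n) : times T t ->
  \int[Pr]_w dotv (x t w) (X *m x t w) =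
  dotv x0 (X *m x0) + \int[muP]_(z in strip t%:E) generator X (xv z) (av z).
Proof.
move=> tT; have sx := sqint_state tT; have sa := sqint_drift tT.
have i1 := integrable_dotv (mS t) sx (sX X sa).
have i2 := integrable_dotv (mS t) sa (sX X sx).
have i3 i j := integrable_dotv (mS t) (sN i tT) (sX X (sN j tT)).
have i4 i j := integrableZl (mS t) (K i j) (i3 i j).
have i5 i := integrable_Rsum (mS t) (index_enum 'I_q) (i4 i).
have i6 := integrable_Rsum (mS t) (index_enum 'I_q) i5.
rewrite /generator (RintegralD (mS t) (integrableD (mS t) i1 i2) i6).
rewrite (RintegralD (mS t) i1 i2) (Rintegral_sum (mS t) _ i5).
rewrite (Rintegral_dotv (mS t) X sx sa) (Rintegral_dotv (mS t) X sa sx).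
under [X in _ + (_ + X)]eq_bigr => i _ do
  (rewrite (Rintegral_sum (mS t) _ (i4 i)); under eq_bigr => j _ do
    rewrite (RintegralZl _ (mS t) (i3 i j))
      (Rintegral_dotv (mS t) X (sN i tT) (sN j tT))).
have sxt := sqint_state_at tT.
rewrite (Rintegral_dotv measurableT X sxt sxt).
under [LHS]eq_bigr => k _ do
  (under eq_bigr => l _ do rewrite (second_moment k l tT) !mulrDr; rewrite !big_split/=).
rewrite !big_split/= -!addrA; congr (_ + (_ + (_ + _))).
  rewrite dotvE; apply: eq_bigr => k _; rewrite mxE mulr_sumr.
  by apply: eq_bigr => l _; ring.
under eq_bigr => k _ do under eq_bigr => l _ do
  (rewrite mulr_sumr; under eq_bigr => i _ do rewrite mulr_sumr).
under eq_bigr => k _ do rewrite exchange_big/=.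
rewrite exchange_big/=; apply: eq_bigr => i _.
under eq_bigr => k _ do rewrite exchange_big/=.
rewrite exchange_big/=; apply: eq_bigr => j _.
rewrite mulr_sumr; apply: eq_bigr => k _; rewrite mulr_sumr.
by apply: eq_bigr => l _; ring.
Qed.

End energy_identity.

(** * Quadratic forms *)

Section bilinear_form.
Context {R : realType}.
Implicit Types n m p q : nat.

Lemma dotvC n (v w : 'cV[R]_n) : dotv v w = dotv w v.
Proof. by rewrite !dotvE; apply: eq_bigr => k _; rewrite mulrC. Qed.

Lemma dotvDr n (v w w' : 'cV[R]_n) : dotv v (w + w') = dotv v w + dotv v w'.
Proof. by rewrite /dotv mulmxDr mxE. Qed.

Lemma dotvNr n (v w : 'cV[R]_n) : dotv v (- w) = - dotv v w.
Proof. by rewrite /dotv mulmxN mxE. Qed.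

Lemma dotvZr n a (v w : 'cV[R]_n) : dotv v (a *: w) = a * dotv v w.
Proof. by rewrite /dotv -scalemxAr mxE. Qed.

Lemma dotv0r n (v : 'cV[R]_n) : dotv v 0 = 0.
Proof. by rewrite /dotv mulmx0 mxE. Qed.

Lemma dotv_sumr n (I : Type) (s : seq I) (v : 'cV[R]_n) (w : I -> 'cV[R]_n) :
  dotv v (\sum_(i <- s) w i) = \sum_(i <- s) dotv v (w i).
Proof. exact: (big_morph _ (dotvDr v) (dotv0r v)). Qed.

Lemma dotvDl n (v w w' : 'cV[R]_n) : dotv (w + w') v = dotv w v + dotv w' v.
Proof. by rewrite !(dotvC _ v) dotvDr. Qed.

Lemma dotvNl n (v w : 'cV[R]_n) : dotv (- w) v = - dotv w v.
Proof. by rewrite !(dotvC _ v) dotvNr. Qed.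

Lemma dotvZl n a (v w : 'cV[R]_n) : dotv (a *: w) v = a * dotv w v.
Proof. by rewrite !(dotvC _ v) dotvZr. Qed.

Lemma dotv_mull n p (M : 'M[R]_(p, n)) v w : dotv (M *m v) w = dotv v (M^T *m w).
Proof. by rewrite /dotv trmx_mul mulmxA. Qed.

Lemma dotv_noise_term n q (N : 'I_q -> 'M[R]_n) (K : 'M[R]_q) (X : 'M[R]_n) v :
  dotv v (noise_term N K X *m v) =
  \sum_i \sum_j K i j * dotv (N i *m v) (X *m (N j *m v)).
Proof.
rewrite /noise_term mulmx_suml dotv_sumr; apply: eq_bigr => i _.
rewrite mulmx_suml dotv_sumr; apply: eq_bigr => j _.
by rewrite -scalemxAl dotvZr dotv_mull !mulmxA.
Qed.

Lemma generatorE n q (N : 'I_q -> 'M[R]_n) (K : 'M[R]_q) (A X : 'M[R]_n) v b :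
  X^T = X ->
  generator K N X v (A *m v + b) =
  dotv v ((A^T *m X + X *m A + noise_term N K X) *m v) + 2 * dotv v (X *m b).
Proof.
move=> XT; rewrite /generator mulmxDr dotvDr dotvDl !mulmxDl !dotvDr.
rewrite dotv_noise_term (dotv_mull A) (dotvC b) (dotv_mull X) XT !mulmxA; ring.
Qed.

Lemma posdefmx_unit n (P : 'M[R]_n) : posdefmx P -> P \in unitmx.
Proof.
move=> [PT Pp]; rewrite -row_free_unit; apply: inj_row_free => v vP0.
apply/eqP/negPn/negP => v0.
have vT0 : v^T != 0 by apply: contra v0 => /eqP vT; rewrite -[v]trmxK vT trmx0.
have := Pp _ vT0.
by rewrite -PT -trmx_mul vP0 trmx0 dotv0r ltxx.
Qed.

Lemma eigen_posdef n (P : 'M[R]_n) e lambda : posdefmx P ->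
  dotv e e = 1 -> P *m e = lambda *: e -> 0 < lambda.
Proof.
move=> [PT Pp] e1 Pe; have e0 : e != 0.
  by apply/negP => /eqP e0; move/eqP: e1; rewrite e0 dotv0r eq_sym oner_eq0.
by have := Pp _ e0; rewrite Pe dotvZr e1 mulr1.
Qed.

Lemma sym_invmx n (P : 'M[R]_n) : P^T = P -> (invmx P)^T = invmx P.
Proof. by move=> PT; rewrite trmx_inv PT. Qed.

(** Cauchy-Schwarz for the form of P^-1, in completed-square form: at v - <v, e> e the form takes
    the value v'P^-1 v - <v, e>^2 / lambda. *)
Lemma dotv_eigen_sqr_le n (P : 'M[R]_n) e lambda v : posdefmx P ->
  dotv e e = 1 -> P *m e = lambda *: e ->
  dotv v e ^+ 2 <= lambda * dotv v (invmx P *m v).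
Proof.
move=> Pp e1 Pe; have l0 := eigen_posdef Pp e1 Pe.
have Pu := posdefmx_unit Pp; have [PT Pq] := Pp; have XT := sym_invmx PT.
set X := invmx P in XT *.
have Xe : X *m e = lambda^-1 *: e.
  have : X *m (P *m e) = e by rewrite mulmxA mulVmx// mul1mx.
  rewrite Pe -scalemxAr => XPe.
  by rewrite -[in RHS]XPe scalerA mulVf ?gt_eqF// scale1r.
(* The form of P^-1 at y is the form of P at P^-1 y. *)
have Xpos y : 0 <= dotv y (X *m y).
  have -> : dotv y (X *m y) = dotv (X *m y) (P *m (X *m y)).
    by rewrite mulmxA mulmxV// mul1mx dotvC.
  have [->|Xy] := eqVneq (X *m y) 0; first by rewrite mulmx0 dotv0r.
  exact/ltW/Pq.
have eXv : dotv e (X *m v) = lambda^-1 * dotv v e.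
  by rewrite -XT -dotv_mull Xe dotvZl dotvC.
have := Xpos (v - dotv v e *: e).
rewrite mulmxBr -scalemxAr Xe !(dotvDr, dotvDl, dotvNr, dotvNl, dotvZr, dotvZl).
rewrite e1 eXv => H.
rewrite -ler_pdivrMl//; move: H; set c := dotv v e; set b := dotv v (X *m v) => H.
by rewrite -subr_ge0 (le_trans H)// le_eqVlt; apply/orP; left; apply/eqP; ring.
Qed.

(** With z = B'P^-1 v the generator is v'G v + 2 z'u. The matrix inequality bounds v'G v by |C v|^2
    - |z|^2, and |z - u|^2 >= 0 bounds 2 z'u by |z|^2 + |u|^2. *)
Lemma reachability_generator_le n m p q (A : 'M[R]_n) (B : 'M[R]_(n, m))
    (C : 'M[R]_(p, n)) (N : 'I_q -> 'M[R]_n) (K : 'M[R]_q) (P : 'M[R]_n) v u :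
  posdefmx P -> reachability_ineq A B C N K P ->
  generator K N (invmx P) v (A *m v + B *m u) <= sqnorm u + sqnorm (C *m v).
Proof.
move=> [PT _] [_ /(_ v)]; have XT := sym_invmx PT; set X := invmx P in XT *.
rewrite (generatorE _ _ _ _ _ XT) sub0r mulNmx dotvNr oppr_ge0.
set G := A^T *m X + X *m A + noise_term N K X.
rewrite mulmxDl mulmxBl !(dotvDr, dotvNr).
pose z := B^T *m X *m v.
have zE w : dotv v (X *m B *m w) = dotv z w.
  by rewrite /z dotv_mull trmx_mul trmxK XT.
have -> : dotv v (C^T *m C *m v) = sqnorm (C *m v) by rewrite -mulmxA -dotv_mull.
have -> : dotv v (X *m B *m B^T *m X *m v) = dotv z z by rewrite -zE /z !mulmxA.
have -> : dotv v (X *m (B *m u)) = dotv z u by rewrite -zE mulmxA.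
have := sqnorm_ge0 (z - u).
rewrite /sqnorm !(dotvDr, dotvDl, dotvNr, dotvNl) (dotvC u z); lra.
Qed.

(** With z = B'Q v the Riccati equation reads v'G v = |z|^2 - |C v|^2, and u = -z contributes -2
    |z|^2. *)
Lemma riccati_generatorE n m p q (A : 'M[R]_n) (B : 'M[R]_(n, m))
    (C : 'M[R]_(p, n)) (N : 'I_q -> 'M[R]_n) (K : 'M[R]_q) (Q : 'M[R]_n) v :
  Q^T = Q -> riccati_eq A B C N K Q ->
  let u := - (B^T *m Q) *m v in
  generator K N Q v (A *m v + B *m u) = - (sqnorm u + sqnorm (C *m v)).
Proof.
move=> QT ric u; rewrite (generatorE _ _ _ _ _ QT).
move: ric; rewrite /riccati_eq.
set G := A^T *m Q + Q *m A + noise_term N K Q => ric.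
have GE : G = Q *m B *m B^T *m Q - C^T *m C.
  by apply/eqP; rewrite -subr_eq0 opprB addrA ric.
pose z := B^T *m Q *m v.
have zE w : dotv v (Q *m B *m w) = dotv z w.
  by rewrite /z dotv_mull trmx_mul trmxK QT.
have uE : u = - z by rewrite /u /z mulNmx.
have -> : dotv v (G *m v) = dotv z z - sqnorm (C *m v).
  rewrite GE mulmxBl dotvDr dotvNr -zE /z !mulmxA.
  by rewrite -[C^T *m C *m v]mulmxA -dotv_mull.
have -> : dotv v (Q *m (B *m u)) = dotv z u by rewrite -zE mulmxA.
by rewrite uE /sqnorm !(dotvNr, dotvNl); ring.
Qed.

End bilinear_form.

(** * Cost functional *)

Section cost.
Context {R : realType} {d : measure_display} {Omega : measurableType d}.
Variables (Pr : probability Omega R) (F : R -> set_system Omega).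
Hypothesis HF : is_filtration Pr F.

Local Notation mu := (@lebesgue_measure R).
Local Notation RT := (measurableTypeR R).
Local Notation muP := (mu \x Pr)%E.

Lemma adapted_mulmx n p T (M : 'M[R]_(p, n)) (v : R -> Omega -> 'cV[R]_n) :
  adapted F T v -> adapted F T (fun t w => M *m v t w).
Proof.
move=> adv t k tT; have [t0 _] := tT.
have sF := filtration_sigma_algebra HF t0.
have -> : (fun w => (M *m v t w) k 0) = (fun w => \sum_j M k j * v t w j 0).
  by apply/funext => w; rewrite mxE.
apply: measurable_wrt_sum => // j; apply: measurable_wrtM => //.
  exact: measurable_wrt_cst.
exact: adv.
Qed.

Lemma jointly_measurable_mulmx n p T (M : 'M[R]_(p, n))
    (v : R -> Omega -> 'cV[R]_n) :
  jointly_measurable T v -> jointly_measurable T (fun t w => M *m v t w).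
Proof.
move=> mv k.
have -> : (fun z : R * Omega => (M *m v z.1 z.2) k 0) =
    (fun z => \sum_j M k j * v z.1 z.2 j 0).
  by apply/funext => z; rewrite mxE.
by apply: measurable_sum => j; apply: measurable_funM => //; exact: mv.
Qed.

Lemma measurable_sqnorm n T (v : R -> Omega -> 'cV[R]_n) :
  jointly_measurable T v ->
  measurable_fun (strip T) (fun z : RT * Omega => sqnorm (v z.1 z.2)).
Proof.
move=> mv.
have mv' j : measurable_fun (strip T) (fun z : RT * Omega => v z.1 z.2 j 0) := mv j.
have -> : (fun z : RT * Omega => sqnorm (v z.1 z.2)) =
    (fun z => \sum_j v z.1 z.2 j 0 ^+ 2) by apply/funext => z; rewrite sqnormE.
by apply: measurable_sum => j; exact: measurable_funX.
Qed.

Lemma L2norm2_strip n T (v : R -> Omega -> 'cV[R]_n) : jointly_measurable T v ->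
  L2norm2 Pr T v = (\int[muP]_(z in strip T) (sqnorm (v z.1 z.2))%:E)%E.
Proof.
move=> mv.
have mv' : measurable_fun (strip T) (fun z : RT * Omega => (sqnorm (v z.1 z.2))%:E).
  by apply/measurable_EFinP; exact: measurable_sqnorm.
rewrite (tonelli_strip2 mu Pr (measurable_times T) mv')//.
by move=> z _; rewrite lee_fin sqnorm_ge0.
Qed.

Section two_processes.
Variables (m p : nat) (T : \bar R).
Variables (u : R -> Omega -> 'cV[R]_m) (y : R -> Omega -> 'cV[R]_p).
Hypotheses (mu_ : jointly_measurable T u) (my : jointly_measurable T y).

Let c (z : RT * Omega) : R := sqnorm (u z.1 z.2) + sqnorm (y z.1 z.2).

Let c0 z : (0 <= (c z)%:E)%E.
Proof. by rewrite lee_fin addr_ge0// sqnorm_ge0. Qed.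

Let mc : measurable_fun (strip T) (fun z => (c z)%:E).
Proof.
by apply/measurable_EFinP; apply: measurable_funD; exact: measurable_sqnorm.
Qed.

Let mcS t : times T t -> measurable_fun (strip t%:E) (fun z => (c z)%:E).
Proof.
move=> tT; apply: measurable_funS mc; first exact: measurable_time_strip.
exact: strip_le.
Qed.

(** [cost] takes the expectation inside and [L2norm2] outside; the integral over the strip is their
    common form. *)
Lemma cost_strip : cost Pr T u y = (\int[muP]_(z in strip T) (c z)%:E)%E.
Proof.
rewrite (tonelli_strip1 mu Pr (measurable_times T) mc) => [|z _]; last exact: c0.
by apply: eq_integral => s _; rewrite unlock.
Qed.

Lemma cost_strip_at t : times T t ->
  cost Pr t%:E u y = (\int[muP]_(z in strip t%:E) (c z)%:E)%E.
Proof.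
move=> tT.
rewrite (tonelli_strip1 mu Pr (measurable_times t%:E) (mcS tT)) => [|z _]; last exact: c0.
by apply: eq_integral => s _; rewrite unlock.
Qed.

Lemma cost_le t : times T t -> (cost Pr t%:E u y <= cost Pr T u y)%E.
Proof.
move=> tT; rewrite cost_strip cost_strip_at//.
apply: ge0_subset_integral; [exact: measurable_time_strip|
  exact: measurable_time_strip|exact: mc|by move=> z _; exact: c0|exact: strip_le].
Qed.

Lemma cost_L2norm2 : cost Pr T u y = (L2norm2 Pr T y + L2norm2 Pr T u)%E.
Proof.
rewrite cost_strip !L2norm2_strip// -ge0_integralD.
- by apply: eq_integral => z _; rewrite /c EFinD addeC.
- exact: measurable_time_strip.
- by move=> z _; rewrite lee_fin sqnorm_ge0.
- by apply/measurable_EFinP; exact: measurable_sqnorm.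
- by move=> z _; rewrite lee_fin sqnorm_ge0.
- by apply/measurable_EFinP; exact: measurable_sqnorm.
Qed.

(** Monotone convergence along the strips [0, k] x Omega, which exhaust the half-line by the
    Archimedean property. *)
Lemma cost_sup (M : \bar R) : T = +oo%E ->
  (forall t, times T t -> (cost Pr t%:E u y <= M)%E) -> (cost Pr T u y <= M)%E.
Proof.
move=> Ty H; rewrite cost_strip.
pose G (k : nat) : set (RT * Omega) := strip k%:R%:E.
have GT k : times T k%:R.
  by split; [exact: ler0n|rewrite Ty leey].
have -> : strip T = \bigcup_k G k.
  apply/seteqP; split=> [[s w] [[/= s0 _] _]|z [k _ Gkz]].
    exists (Num.bound s) => //; split => //; split => //=.
    by rewrite lee_fin ltW//; exact: archi_boundP.
  exact: strip_le (GT k) _ Gkz.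
have ndG : nondecreasing_seq G.
  move=> k l kl; apply/subsetPset; apply: strip_le; split => //.
  by rewrite lee_fin ler_nat.
have mG k : measurable (G k) by exact: measurable_time_strip.
have cvg := ge0_nondecreasing_set_cvg_integral (mu := muP) ndG mG
  (fun k => mcS (GT k)) (fun k z _ => c0 z).
rewrite -(cvg_lim _ cvg)//; apply: lime_le; first by apply/cvg_ex; eexists; exact: cvg.
apply: nearW => k.
by rewrite -(cost_strip_at (GT k)); exact: H.
Qed.

End two_processes.

Lemma cost_finite m p t (u : R -> Omega -> 'cV[R]_m) (y : R -> Omega -> 'cV[R]_p) :
  jointly_measurable t%:E u -> jointly_measurable t%:E y ->
  sqintv muP (strip t%:E) (fun z => u z.1 z.2) ->
  sqintv muP (strip t%:E) (fun z => y z.1 z.2) ->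
  muP.-integrable (strip t%:E)
    (EFin \o (fun z => sqnorm (u z.1 z.2) + sqnorm (y z.1 z.2))) /\
  cost Pr t%:E u y = (\int[muP]_(z in strip t%:E)
    (sqnorm (u z.1 z.2) + sqnorm (y z.1 z.2)))%:E.
Proof.
move=> mu_ my su sy; have mS := measurable_time_strip (Omega := Omega) t%:E.
have i1 := integrable_dotv mS su su; have i2 := integrable_dotv mS sy sy.
have i := integrableD mS i1 i2; split; first exact: i.
rewrite cost_strip// fineK//.
exact: (integrable_fin_num mS i).
Qed.

End cost.

(** * Energy bounds for the controlled system *)

Section controlled_system.
Context {R : realType} {d : measure_display} {Omega : measurableType d}.
Variables (Pr : probability Omega R) (F : R -> set_system Omega).
Hypothesis HF : is_filtration Pr F.
Variables (n m p q : nat) (K : 'M[R]_q) (W : R -> Omega -> 'cV[R]_q).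
Hypothesis HW : is_wiener Pr F K W.
Variables (A : 'M[R]_n) (B : 'M[R]_(n, m)) (C : 'M[R]_(p, n)) (N : 'I_q -> 'M[R]_n).

Local Notation mu := (@lebesgue_measure R).
Local Notation RT := (measurableTypeR R).
Local Notation muP := (mu \x Pr)%E.

Lemma jointly_measurableS k (T : \bar R) t (v : R -> Omega -> 'cV[R]_k) :
  times T t -> jointly_measurable T v -> jointly_measurable t%:E v.
Proof.
move=> tT mv j.
exact: (measurable_funS (measurable_time_strip T) (strip_le tT) (mv j)).
Qed.

Lemma EFin_integral_form t (X : 'M[R]_n) (x : R -> Omega -> 'cV[R]_n) :
  sqintv Pr setT (x t) ->
  (\int[Pr]_w dotv (x t w) (X *m x t w))%:E =
  (\int[Pr]_w (dotv (x t w) (X *m x t w))%:E)%E.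
Proof.
move=> sx; rewrite fineK//; apply: (integrable_fin_num measurableT).
exact: (integrable_dotv measurableT sx (sqintvM measurableT X sx)).
Qed.

Section state.
Variables (T : \bar R) (x0 : 'cV[R]_n).
Variables (u : R -> Omega -> 'cV[R]_m) (x : R -> Omega -> 'cV[R]_n).
Hypothesis adu : adapted F T u.
Hypothesis mu_ : jointly_measurable T u.
Hypothesis squ : forall t, times T t ->
  sqintv muP (strip t%:E) (fun z => u z.1 z.2).
Hypothesis sol : is_state Pr F W A B N T x0 u x.

Let mx : jointly_measurable T x. Proof. by have [_ []] := sol. Qed.

Let my : jointly_measurable T (output C x).
Proof. exact: jointly_measurable_mulmx. Qed.

Let sqb t : times T t -> sqintv muP (strip t%:E) (fun z => B *m u z.1 z.2).
Proof.
by move=> tT; apply: sqintvM; [exact: measurable_time_strip|exact: squ].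
Qed.

Let adb : adapted F T (fun t w => B *m u t w).
Proof. exact: (adapted_mulmx HF). Qed.

Lemma state_integrable_cost t : times T t ->
  muP.-integrable (strip t%:E) (EFin \o (fun z : RT * Omega =>
    sqnorm (u z.1 z.2) + sqnorm (output C x z.1 z.2))) /\
  cost Pr t%:E u (output C x) = (\int[muP]_(z in strip t%:E)
    (sqnorm (u z.1 z.2) + sqnorm (output C x z.1 z.2)))%:E.
Proof.
move=> tT; apply: cost_finite.
- exact: jointly_measurableS mu_.
- exact: jointly_measurableS my.
- exact: squ.
- apply: sqintvM; first exact: measurable_time_strip.
  exact: (sqint_state sol tT).
Qed.

Lemma cost_state_le t : times T t ->
  (cost Pr t%:E u (output C x) <= cost Pr T u (output C x))%E.
Proof. exact: cost_le. Qed.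

Lemma cost_state_sup (M : \bar R) : T = +oo%E ->
  (forall t, times T t -> (cost Pr t%:E u (output C x) <= M)%E) ->
  (cost Pr T u (output C x) <= M)%E.
Proof. exact: cost_sup. Qed.

Lemma cost_state_L2norm2 : cost Pr T u (output C x) =
  (L2norm2 Pr T (output C x) + L2norm2 Pr T u)%E.
Proof. exact: cost_L2norm2. Qed.

Lemma state_energy_le t (P : 'M[R]_n) : times T t -> posdefmx P ->
  reachability_ineq A B C N K P ->
  ((\int[Pr]_w dotv (x t w) (invmx P *m x t w))%:E <=
   (dotv x0 (invmx P *m x0))%:E + cost Pr t%:E u (output C x))%E.
Proof.
move=> tT Pp ineq; have [ic ->] := state_integrable_cost tT.
rewrite (energy_identity HF HW sol adb sqb (invmx P) tT) -EFinD lee_fin lerD2l.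
apply: le_Rintegral => //; first exact: measurable_time_strip.
  exact: (integrable_generator K sol sqb (invmx P) tT).
by move=> z _; exact: reachability_generator_le.
Qed.

(** The energy at t is bounded by the cost up to t, which is monotone in the horizon; finite and
    infinite T are thereby treated alike. *)
Lemma state_coordinate_le t (P : 'M[R]_n) e lambda : times T t -> posdefmx P ->
  reachability_ineq A B C N K P -> dotv e e = 1 -> P *m e = lambda *: e ->
  x0 = 0 ->
  ('E_Pr[fun w => (dotv (x t w) e ^+ 2)%R] <=
   lambda%:E * cost Pr T u (output C x))%E.
Proof.
move=> tT Pp ineq e1 Pe x00; have l0 := eigen_posdef Pp e1 Pe.
have sx := sqint_state_at HF HW sol sqb tT.
have ix := integrable_dotv measurableT sx (sqintvM measurableT (invmx P) sx).
apply: (@le_trans _ _ (lambda%:E * (\int[Pr]_w dotv (x t w) (invmx P *m x t w))%:E)%E);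
  last first.
  rewrite lee_pmul2l ?lte_fin//.
  apply: le_trans (state_energy_le tT Pp ineq) _.
  by rewrite x00 mulmx0 dotv0r add0e; exact: cost_state_le.
rewrite (EFin_integral_form _ sx) -integralZl// unlock.
apply: ge0_le_integral => //.
- by move=> w _; rewrite lee_fin sqr_ge0.
- apply/measurable_EFinP; apply: measurable_funX.
  have -> : (fun w => dotv (x t w) e) = (fun w => \sum_k x t w k 0 * e k 0).
    by apply/funext => w; rewrite dotvE.
  apply: measurable_sum => k; apply: measurable_funM => //.
  exact: sqint_measurable (sx k).
- exact: measurable_int (integrableZl measurableT lambda ix).
- by move=> w _; rewrite -EFinM lee_fin; exact: dotv_eigen_sqr_le.
Qed.

(** The energy identity makes the cost up to t equal to x0'Q x0 - E x(t)'Q x(t), and the subtracted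
    term is nonnegative. *)
Lemma feedback_energy t (Q : 'M[R]_n) : times T t -> possemidefmx Q ->
  riccati_eq A B C N K Q -> (forall s w, u s w = - (B^T *m Q) *m x s w) ->
  (cost Pr t%:E u (output C x) <= (dotv x0 (Q *m x0))%:E)%E.
Proof.
move=> tT [QT Qp] ric uE; have [ic ->] := state_integrable_cost tT.
have := energy_identity HF HW sol adb sqb Q tT.
rewrite [X in _ + X](_ : _ = - \int[muP]_(z in strip t%:E)
    (sqnorm (u z.1 z.2) + sqnorm (output C x z.1 z.2))); last first.
  rewrite -mulN1r -(RintegralZl _ (measurable_time_strip _) ic).
  apply: eq_Rintegral => z _; rewrite uE mulN1r.
  exact: riccati_generatorE.
move=> H; rewrite lee_fin -subr_ge0 -H; apply: Rintegral_ge0 => w _.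
exact: Qp.
Qed.

End state.
End controlled_system.

Theorem proposition3p3 (R : realType) (d : measure_display)
    (Omega : measurableType d) (Pr : probability Omega R)
    (F : R -> set_system Omega) (HF : is_filtration Pr F)
    (n m p q : nat) (K : 'M[R]_q) (W : R -> Omega -> 'cV[R]_q)
    (HW : is_wiener Pr F K W)
    (A : 'M[R]_n) (B : 'M[R]_(n, m)) (C : 'M[R]_(p, n)) (N : 'I_q -> 'M[R]_n)
    (Hstab : stabilizable Pr F W A B N)
    (Hobs : observable Pr F W A C N)
    (HP : exists P : 'M[R]_n, posdefmx P /\ reachability_ineq A B C N K P) :
  (forall (P : 'M[R]_n) (e : 'I_n -> 'cV[R]_n) (lambda : 'I_n -> R),
     posdefmx P -> reachability_ineq A B C N K P ->
     orthonormal_eigenbasis P e lambda ->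
     (forall (T : R) (u : R -> Omega -> 'cV[R]_m) (x : R -> Omega -> 'cV[R]_n),
        0 < T -> inL2 Pr F T%:E u -> is_state Pr F W A B N T%:E 0 u x ->
        forall i,
          (ereal_sup [set 'E_Pr[fun w => (dotv (x t w) (e i) ^+ 2)%R] | t in times T%:E]
             <= (lambda i)%:E * cost Pr T%:E u (output C x))%E)
     /\
     (forall (u : R -> Omega -> 'cV[R]_m) (x : R -> Omega -> 'cV[R]_n),
        inL2 Pr F +oo%E u -> is_state Pr F W A B N +oo%E 0 u x -> inL2 Pr F +oo%E x ->
        forall i,
          (ereal_sup [set 'E_Pr[fun w => (dotv (x t w) (e i) ^+ 2)%R] | t in times +oo%E]
             <= (lambda i)%:E * cost Pr +oo%E u (output C x))%E))
  /\
  (forall (Q : 'M[R]_n) (e : 'I_n -> 'cV[R]_n) (lambda : 'I_n -> R),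
     possemidefmx Q -> riccati_eq A B C N K Q ->
     mean_square_stable Pr F W (A - B *m B^T *m Q) N ->
     orthonormal_eigenbasis Q e lambda ->
     forall (i : 'I_n) (x : R -> Omega -> 'cV[R]_n),
       let u : R -> Omega -> 'cV[R]_m := fun t w => - (B^T *m Q) *m x t w in
       let y := output C x in
       is_state Pr F W A B N +oo%E (e i) u x ->
       cost Pr +oo%E u y = (L2norm2 Pr +oo%E y + L2norm2 Pr +oo%E u)%E /\
       (cost Pr +oo%E u y <= (lambda i)%:E)%E).
Proof.
split=> [P e lambda Pp ineq [eo ee]|Q e lambda Qp ric _ [eo ee] i x u y sol].
  (* An extended horizon covers both claims of the first part. *)
  have bound (T : \bar R) (u : R -> Omega -> 'cV[R]_m) (x : R -> Omega -> 'cV[R]_n) :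
      inL2 Pr F T u -> is_state Pr F W A B N T 0 u x -> forall i,
      (ereal_sup [set 'E_Pr[fun w => (dotv (x t w) (e i) ^+ 2)%R] | t in times T]
        <= (lambda i)%:E * cost Pr T u (output C x))%E.
    move=> uL2 sol i; have [adu mu_ _] := uL2.
    have squ t : times T t -> sqintv (@lebesgue_measure R \x Pr)%E (strip t%:E)
        (fun z => u z.1 z.2).
      move=> tT; apply: sqintvS (inL2_sqintv uL2); try exact: measurable_time_strip.
      exact: strip_le.
    apply: ge_ereal_sup => _ [t tT <-].
    apply: (state_coordinate_le HF HW adu mu_ squ sol tT Pp ineq _ (ee i)) => //.
    by rewrite eo eqxx.
  split=> [T u x _ uL2 sol i|u x uL2 sol _ i]; exact: bound.
have [inx [adx mx] _ _] := sol.
have adu : adapted F +oo%E u by exact: (adapted_mulmx HF).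
have mu_ : jointly_measurable +oo%E u by exact: jointly_measurable_mulmx.
have squ t : times +oo%E t -> sqintv (@lebesgue_measure R \x Pr)%E (strip t%:E)
    (fun z => u z.1 z.2).
  move=> tT; apply: sqintvM; first exact: measurable_time_strip.
  exact: inL2_sqintv (inx t tT).
split; first exact: cost_state_L2norm2 mu_ sol.
apply: (cost_state_sup mu_ sol) => // t tT.
(* The initial state is a unit eigenvector, so its Q-energy, which bounds every finite-horizon cost,
   is the eigenvalue. *)
have -> : lambda i = dotv (e i) (Q *m e i) by rewrite ee dotvZr eo eqxx mulr1.
exact: (feedback_energy HF HW adu mu_ squ sol tT Qp ric).
Qed.
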